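(* Let $q:\mathbb{Z}^n\to\mathbb{Z}$ be a connected unit integral quadratic form $q(x)=\sum_{i=1}^n x(i)^2+\sum_{i<j}a_{ij}x(i)x(j)$ with $a_{ij}\in\{-1,0,1\}$. If $q$ is weakly positive and positive semi-definite, then $L(q,\mathfrak{r})\simeq G^+(q)$ as Lie algebras.
   Context: Let $e_1,\ldots,e_n$ be the standard basis of $\mathbb{Z}^n$, $a_{ji}=a_{ij}$, $\langle x,y\rangle_q=q(x+y)-q(x)-q(y)$. $q$ is connected if the graph on $\{1,\ldots,n\}$ in which $i\neq j$ are joined iff $a_{ij}\ne0$ is connected; weakly positive if $q(x)>0$ for all $0\neq x\in\mathbb{N}^n$; positive semi-definite if $q(x)\ge0$ for all $x\in\mathbb{Z}^n$. Write $[y_1,\ldots,y_m]=[y_1,[y_2,[\ldots[y_{m-1},y_m]]]]$. Let $L(q)$ be the free complex Lie algebra on $v_1,\ldots,v_n$. A standard multibracket $[v_{i_1},\ldots,v_{i_m}]$ is a root (a property of the sequence $i_1,\ldots,i_m$) if $m\ge1$ and $\langle e_{i_k},e_{i_{k+1}}+\cdots+e_{i_m}\rangle_q=-1$ for $k=1,\ldots,m-1$. $\mathfrak{r}$ is the set of all standard multibrackets $[v_{i_1},\ldots,v_{i_m}]$ that are not roots but for which $[v_{i_2},\ldots,v_{i_m}]$ is a root; $L(q,\mathfrak{r})=L(q)/(\mathfrak{r})$. $G(q)$ is the complex Lie algebra with generators $x_i,x_{-i},h_i$ ($i=1,\ldots,n$) and relations, with $c_{ij}=\langle e_i,e_j\rangle_q$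 and $\varepsilon,\varepsilon_j\in\{-1,1\}$: (1) $[h_i,h_j]=0$ for all $i,j$; (2) $[h_i,x_{\varepsilon j}]=\varepsilon c_{ij}x_{\varepsilon j}$ for all $i,j$; (3) $[x_{\varepsilon i},x_{-\varepsilon i}]=\varepsilon h_i$ for all $i$; (4) $[x_{\varepsilon_1i_1},\ldots,x_{\varepsilon_mi_m}]=0$ whenever $q(\varepsilon_1e_{i_1}+\cdots+\varepsilon_me_{i_m})>1$ ($m$ arbitrary). $G^+(q)$ is the Lie subalgebra of $G(q)$ generated by $x_1,\ldots,x_n$. *)

(* Defs.v *)
From HB Require Import structures.
From mathcomp Require Import all_boot all_order all_algebra.
From mathcomp Require Import generic_quotient ring_quotient boolp reals complex.

Set Implicit Arguments.
Unset Strict Implicit.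
Unset Printing Implicit Defensive.
Import GRing.Theory.
Local Open Scope ring_scope.
Local Open Scope quotient_scope.

HB.mixin Record Lmodule_isLie (K : fieldType) L of GRing.Lmodule K L := {
  lie : L -> L -> L;
  lieDl : forall x y z, lie (x + y) z = lie x z + lie y z;
  lieZl : forall (c : K) x y, lie (c *: x) y = c *: lie x y;
  lieDr : forall x y z, lie x (y + z) = lie x y + lie x z;
  lieZr : forall (c : K) x y, lie x (c *: y) = c *: lie x y;
  liexx : forall x, lie x x = 0;
  lie_jacobi : forall x y z,
    lie x (lie y z) + lie y (lie z x) + lie z (lie x y) = 0
}.

#[short(type="lieAlgType")]
HB.structure Definition LieAlgebra (K : fieldType) :=
  {L of Lmodule_isLie K L & GRing.Lmodule K L}.

Notation "[lie x , y ]" := (lie x y)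
  (at level 0, x, y at level 99, format "[lie  x ,  y ]") : ring_scope.

Definition lie_isomorphic (K : fieldType) (L M : lieAlgType K) : Prop :=
  exists f : {linear L -> M},
    bijective f /\ forall x y, f [lie x, y] = [lie f x, f y].

(* [y_1, ..., y_m] = [y_1, [y_2, [... [y_(m-1), y_m]]]]; the value on the empty
   sequence is a junk value. *)
Fixpoint multibracket (K : fieldType) (L : lieAlgType K) (s : seq L) : L :=
  match s with
  | [::] => 0
  | [:: y] => y
  | y :: s' => [lie y, multibracket s']
  end.

(* The free Lie algebra on X consists of the formal Lie expressions in elements
   of X, modulo the smallest congruence containing the Lie algebra axioms. The
   opposite of t is LScale (-1) t. *)
Inductive lie_term (K : fieldType) (X : Type) : Type :=
| LVar of X
| LZero
| LAdd of lie_term K X & lie_term K X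
| LScale of K & lie_term K X
| LLie of lie_term K X & lie_term K X.
Arguments LVar {K X} _.
Arguments LZero {K X}.

HB.instance Definition _ (K : fieldType) (X : Type) :=
  gen_eqMixin (lie_term K X).
HB.instance Definition _ (K : fieldType) (X : Type) :=
  gen_choiceMixin (lie_term K X).

Inductive lie_cong (K : fieldType) (X : Type) :
    lie_term K X -> lie_term K X -> Prop :=
| lc_refl s : lie_cong s s
| lc_sym s t : lie_cong s t -> lie_cong t s
| lc_trans s t u : lie_cong s t -> lie_cong t u -> lie_cong s u
| lc_add s s' t t' : lie_cong s s' -> lie_cong t t' ->
    lie_cong (LAdd s t) (LAdd s' t')
| lc_scale c s s' : lie_cong s s' -> lie_cong (LScale c s) (LScale c s')
| lc_lie s s' t t' : lie_cong s s' -> lie_cong t t' ->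
    lie_cong (LLie s t) (LLie s' t')
| lc_addA s t u : lie_cong (LAdd s (LAdd t u)) (LAdd (LAdd s t) u)
| lc_addC s t : lie_cong (LAdd s t) (LAdd t s)
| lc_add0 s : lie_cong (LAdd LZero s) s
| lc_addN s : lie_cong (LAdd (LScale (-1) s) s) LZero
| lc_scaleA b c s : lie_cong (LScale b (LScale c s)) (LScale (b * c) s)
| lc_scale1 s : lie_cong (LScale 1 s) s
| lc_scaleDr c s t :
    lie_cong (LScale c (LAdd s t)) (LAdd (LScale c s) (LScale c t))
| lc_scaleDl b c s :
    lie_cong (LScale (b + c) s) (LAdd (LScale b s) (LScale c s))
| lc_lieDl s t u : lie_cong (LLie (LAdd s t) u) (LAdd (LLie s u) (LLie t u))
| lc_lieZl c s t : lie_cong (LLie (LScale c s) t) (LScale c (LLie s t))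
| lc_lieDr s t u : lie_cong (LLie s (LAdd t u)) (LAdd (LLie s t) (LLie s u))
| lc_lieZr c s t : lie_cong (LLie s (LScale c t)) (LScale c (LLie s t))
| lc_liexx s : lie_cong (LLie s s) LZero
| lc_jacobi s t u :
    lie_cong (LAdd (LAdd (LLie s (LLie t u)) (LLie t (LLie u s)))
                   (LLie u (LLie s t))) LZero.

Section FreeLie.
Variables (K : fieldType) (X : Type).
Local Notation term := (lie_term K X).

Definition lie_congb (s t : term) : bool := `[< lie_cong s t >].

Lemma lie_congb_equiv : equiv_class_of lie_congb.
Proof.
split=> [s|s t|t s u]; first exact/asboolP/lc_refl.
  by apply/asboolP/asboolP; exact: lc_sym.
by move=> /asboolP st /asboolP tu; apply/asboolP; exact: lc_trans st tu.
Qed.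

Canonical lie_congb_equiv_rel := EquivRelPack lie_congb_equiv.

Definition free_lie : Type := {eq_quot lie_congb}.

HB.instance Definition _ := Choice.on free_lie.
HB.instance Definition _ := EqQuotient.on free_lie.

Definition free_pi (s : term) : free_lie := \pi_free_lie s.

Lemma free_lieP (s t : term) :
  free_pi s = free_pi t <-> lie_cong s t.
Proof.
split=> [/eqmodP/asboolP //|st].
by apply/eqmodP/asboolP.
Qed.

Lemma free_lie_repr (s : term) : lie_cong (repr (free_pi s)) s.
Proof. by apply/free_lieP; rewrite /free_pi reprK. Qed.

Lemma free_pi_ind (P : free_lie -> Prop) :
  (forall s, P (free_pi s)) -> forall x, P x.
Proof. by move=> Ppi x; rewrite -[x]reprK; exact: Ppi. Qed.

Definition free_var (x : X) : free_lie := free_pi (LVar x).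

Definition free_zero : free_lie := free_pi LZero.
(* The operations are locked so that their values are not identified, by
   unfolding, with other classes during rewriting. *)
Definition free_add (x y : free_lie) : free_lie :=
  locked (free_pi (LAdd (repr x) (repr y))).
Definition free_scale (c : K) (x : free_lie) : free_lie :=
  locked (free_pi (LScale c (repr x))).
Definition free_bracket (x y : free_lie) : free_lie :=
  locked (free_pi (LLie (repr x) (repr y))).

Lemma free_addE s t :
  free_add (free_pi s) (free_pi t) = free_pi (LAdd s t).
Proof. by rewrite /free_add -lock; apply/free_lieP/lc_add; exact: free_lie_repr. Qed.

Lemma free_scaleE c s :
  free_scale c (free_pi s) = free_pi (LScale c s).
Proof. by rewrite /free_scale -lock; apply/free_lieP/lc_scale; exact: free_lie_repr. Qed.

Lemma free_bracketE s t :
  free_bracket (free_pi s) (free_pi t) = free_pi (LLie s t).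
Proof. by rewrite /free_bracket -lock; apply/free_lieP/lc_lie; exact: free_lie_repr. Qed.

Let E := (free_addE, free_scaleE, free_bracketE).

Lemma free_addA : associative free_add.
Proof.
by elim/free_pi_ind=> s; elim/free_pi_ind=> t; elim/free_pi_ind=> u; rewrite !E; apply/free_lieP/lc_addA.
Qed.

Lemma free_addC : commutative free_add.
Proof. by elim/free_pi_ind=> s; elim/free_pi_ind=> t; rewrite !E; apply/free_lieP/lc_addC. Qed.

Lemma free_add0 : left_id free_zero free_add.
Proof. by elim/free_pi_ind=> s; rewrite !E; apply/free_lieP/lc_add0. Qed.

Lemma free_addN : left_inverse free_zero (free_scale (-1)) free_add.
Proof. by elim/free_pi_ind=> s; rewrite !E; apply/free_lieP/lc_addN. Qed.

HB.instance Definition _ :=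
  GRing.isZmodule.Build free_lie free_addA free_addC free_add0 free_addN.

Lemma free_scaleA b c x : free_scale b (free_scale c x) = free_scale (b * c) x.
Proof. by elim/free_pi_ind: x => s; rewrite !E; apply/free_lieP/lc_scaleA. Qed.

Lemma free_scale1 : left_id 1 free_scale.
Proof. by elim/free_pi_ind=> s; rewrite !E; apply/free_lieP/lc_scale1. Qed.

Lemma free_scaleDr : right_distributive free_scale +%R.
Proof.
move=> c; elim/free_pi_ind=> s; elim/free_pi_ind=> t.
by rewrite /GRing.add /= !E; apply/free_lieP/lc_scaleDr.
Qed.

Lemma free_scaleDl x : {morph free_scale^~ x : b c / b + c}.
Proof.
by move=> b c; elim/free_pi_ind: x => s; rewrite {2}/GRing.add /= !E; apply/free_lieP/lc_scaleDl.
Qed.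

HB.instance Definition _ := GRing.Zmodule_isLmodule.Build K free_lie
  free_scaleA free_scale1 free_scaleDr free_scaleDl.

Let lE := (erefl : @GRing.scale K free_lie = free_scale,
           erefl : @GRing.add free_lie = free_add,
           erefl : (0 : free_lie) = free_zero).

Lemma free_lieDl x y z :
  free_bracket (x + y) z = free_bracket x z + free_bracket y z.
Proof.
elim/free_pi_ind: x => s; elim/free_pi_ind: y => t; elim/free_pi_ind: z => u.
by rewrite !lE !E; apply/free_lieP/lc_lieDl.
Qed.

Lemma free_lieZl c x y : free_bracket (c *: x) y = c *: free_bracket x y.
Proof.
elim/free_pi_ind: x => s; elim/free_pi_ind: y => t.
by rewrite !lE !E; apply/free_lieP/lc_lieZl.
Qed.

Lemma free_lieDr x y z :
  free_bracket x (y + z) = free_bracket x y + free_bracket x z.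
Proof.
elim/free_pi_ind: x => s; elim/free_pi_ind: y => t; elim/free_pi_ind: z => u.
by rewrite !lE !E; apply/free_lieP/lc_lieDr.
Qed.

Lemma free_lieZr c x y : free_bracket x (c *: y) = c *: free_bracket x y.
Proof.
elim/free_pi_ind: x => s; elim/free_pi_ind: y => t.
by rewrite !lE !E; apply/free_lieP/lc_lieZr.
Qed.

Lemma free_liexx x : free_bracket x x = 0.
Proof. by elim/free_pi_ind: x => s; rewrite !lE !E; apply/free_lieP/lc_liexx. Qed.

Lemma free_jacobi x y z :
  free_bracket x (free_bracket y z) + free_bracket y (free_bracket z x)
  + free_bracket z (free_bracket x y) = 0.
Proof.
elim/free_pi_ind: x => s; elim/free_pi_ind: y => t; elim/free_pi_ind: z => u.
by rewrite !lE !E; apply/free_lieP/lc_jacobi.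
Qed.

HB.instance Definition _ := Lmodule_isLie.Build K free_lie
  free_lieDl free_lieZl free_lieDr free_lieZr free_liexx free_jacobi.

End FreeLie.

Arguments free_var {K X} x.

(* The ideal generated by S; by anticommutativity it is enough to close under
   brackets on the left. *)
Inductive ideal_gen (K : fieldType) (L : lieAlgType K) (S : L -> Prop) :
    L -> Prop :=
| ig_mem x : S x -> ideal_gen S x
| ig_0 : ideal_gen S 0
| ig_add x y : ideal_gen S x -> ideal_gen S y -> ideal_gen S (x + y)
| ig_scale c x : ideal_gen S x -> ideal_gen S (c *: x)
| ig_lie x y : ideal_gen S y -> ideal_gen S [lie x, y].

Section LieQuotient.
Variables (K : fieldType) (L : lieAlgType K) (S : L -> Prop).

Lemma lie_anti (x y : L) : [lie x, y] = - [lie y, x].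
Proof.
apply/eqP; rewrite -subr_eq0 opprK; apply/eqP.
by have := liexx (x + y); rewrite lieDl !lieDr !liexx addr0 add0r.
Qed.

Lemma lieBl (x y z : L) : [lie x - y, z] = [lie x, z] - [lie y, z].
Proof. by rewrite -scaleN1r lieDl lieZl scaleN1r. Qed.

Lemma lieBr (x y z : L) : [lie x, y - z] = [lie x, y] - [lie x, z].
Proof. by rewrite -scaleN1r lieDr lieZr scaleN1r. Qed.

Definition idealb (x : L) : bool := `[< ideal_gen S x >].

Lemma idealb_closed : submod_closed idealb.
Proof.
split=> [|c x y /asboolP Sx /asboolP Sy]; first exact/asboolP/ig_0.
by apply/asboolP/ig_add => //; apply/ig_scale.
Qed.

HB.instance Definition _ := GRing.isSubmodClosed.Build K L idealb idealb_closed.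

Definition lie_quot : Type := Quotient.quot (GRing.ZmodClosed.clone L idealb _).

HB.instance Definition _ := GRing.Zmodule.on lie_quot.
HB.instance Definition _ := EqQuotient.on lie_quot.

Definition lie_pi (x : L) : lie_quot := \pi_lie_quot x.

Lemma lie_piP x y : lie_pi x = lie_pi y <-> ideal_gen S (x - y).
Proof.
split=> [/eqmodP/asboolP //|Sxy].
by apply/eqmodP/asboolP.
Qed.

Lemma lie_pi_repr x : ideal_gen S (repr (lie_pi x) - x).
Proof. by apply/lie_piP; rewrite /lie_pi reprK. Qed.

Lemma lie_piD x y : lie_pi (x + y) = lie_pi x + lie_pi y.
Proof. exact: (raddfD \pi_lie_quot). Qed.

Lemma lie_pi0 : lie_pi 0 = 0.
Proof. exact: (raddf0 \pi_lie_quot). Qed.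

Definition lq_scale (c : K) (x : lie_quot) : lie_quot :=
  locked (lie_pi (c *: repr x)).
Definition lq_bracket (x y : lie_quot) : lie_quot :=
  locked (lie_pi [lie repr x, repr y]).

Lemma lq_scaleE c x : lq_scale c (lie_pi x) = lie_pi (c *: x).
Proof.
rewrite /lq_scale -lock; apply/lie_piP; rewrite -scalerBr.
exact/ig_scale/lie_pi_repr.
Qed.

Lemma lq_bracketE x y : lq_bracket (lie_pi x) (lie_pi y) = lie_pi [lie x, y].
Proof.
rewrite /lq_bracket -lock; apply/lie_piP; set x' := repr _; set y' := repr _.
have -> : [lie x', y'] - [lie x, y] =
    [lie x', y' - y] + (-1) *: [lie y, x' - x].
  rewrite scaleN1r -(lie_anti (x' - x) y).
  by rewrite lieBr lieBl addrA subrK.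
by apply: ig_add; [|apply: ig_scale]; apply/ig_lie/lie_pi_repr.
Qed.

Lemma lie_pi_ind (P : lie_quot -> Prop) :
  (forall x, P (lie_pi x)) -> forall x, P x.
Proof. by move=> Ppi x; rewrite -[x]reprK; exact: Ppi. Qed.

Lemma lq_scaleA b c x : lq_scale b (lq_scale c x) = lq_scale (b * c) x.
Proof. by elim/lie_pi_ind: x => x; rewrite !lq_scaleE scalerA. Qed.

Lemma lq_scale1 : left_id 1 lq_scale.
Proof. by elim/lie_pi_ind=> x; rewrite lq_scaleE scale1r. Qed.

Lemma lq_scaleDr : right_distributive lq_scale +%R.
Proof.
move=> c; elim/lie_pi_ind=> x; elim/lie_pi_ind=> y.
by rewrite -lie_piD !lq_scaleE -lie_piD scalerDr.
Qed.

Lemma lq_scaleDl x : {morph lq_scale^~ x : b c / b + c}.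
Proof.
by move=> b c; elim/lie_pi_ind: x => x; rewrite !lq_scaleE -lie_piD scalerDl.
Qed.

HB.instance Definition _ := GRing.Zmodule_isLmodule.Build K lie_quot
  lq_scaleA lq_scale1 lq_scaleDr lq_scaleDl.

Lemma lie_piZ c x : lie_pi (c *: x) = c *: lie_pi x.
Proof. by rewrite -lq_scaleE. Qed.

Lemma lq_lieDl x y z : lq_bracket (x + y) z = lq_bracket x z + lq_bracket y z.
Proof.
elim/lie_pi_ind: x => x; elim/lie_pi_ind: y => y; elim/lie_pi_ind: z => z.
by rewrite -lie_piD !lq_bracketE -lie_piD lieDl.
Qed.

Lemma lq_lieZl c x y : lq_bracket (c *: x) y = c *: lq_bracket x y.
Proof.
elim/lie_pi_ind: x => x; elim/lie_pi_ind: y => y.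
by rewrite -lie_piZ !lq_bracketE -lie_piZ lieZl.
Qed.

Lemma lq_lieDr x y z : lq_bracket x (y + z) = lq_bracket x y + lq_bracket x z.
Proof.
elim/lie_pi_ind: x => x; elim/lie_pi_ind: y => y; elim/lie_pi_ind: z => z.
by rewrite -lie_piD !lq_bracketE -lie_piD lieDr.
Qed.

Lemma lq_lieZr c x y : lq_bracket x (c *: y) = c *: lq_bracket x y.
Proof.
elim/lie_pi_ind: x => x; elim/lie_pi_ind: y => y.
by rewrite -lie_piZ !lq_bracketE -lie_piZ lieZr.
Qed.

Lemma lq_liexx x : lq_bracket x x = 0.
Proof. by elim/lie_pi_ind: x => x; rewrite lq_bracketE liexx lie_pi0. Qed.

Lemma lq_jacobi x y z :
  lq_bracket x (lq_bracket y z) + lq_bracket y (lq_bracket z x)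
  + lq_bracket z (lq_bracket x y) = 0.
Proof.
elim/lie_pi_ind: x => x; elim/lie_pi_ind: y => y; elim/lie_pi_ind: z => z.
by rewrite !lq_bracketE -!lie_piD lie_jacobi lie_pi0.
Qed.

HB.instance Definition _ := Lmodule_isLie.Build K lie_quot
  lq_lieDl lq_lieZl lq_lieDr lq_lieZr lq_liexx lq_jacobi.

End LieQuotient.

Inductive subalg_gen (K : fieldType) (L : lieAlgType K) (S : L -> Prop) :
    L -> Prop :=
| sg_mem x : S x -> subalg_gen S x
| sg_0 : subalg_gen S 0
| sg_add x y : subalg_gen S x -> subalg_gen S y -> subalg_gen S (x + y)
| sg_scale c x : subalg_gen S x -> subalg_gen S (c *: x)
| sg_lie x y : subalg_gen S x -> subalg_gen S y -> subalg_gen S [lie x, y].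

Section LieSubalgebra.
Variables (K : fieldType) (L : lieAlgType K) (S : L -> Prop).

Definition subalgb (x : L) : bool := `[< subalg_gen S x >].

Lemma subalgb_closed : submod_closed subalgb.
Proof.
split=> [|c x y /asboolP Sx /asboolP Sy]; first exact/asboolP/sg_0.
by apply/asboolP/sg_add => //; apply/sg_scale.
Qed.

HB.instance Definition _ :=
  GRing.isSubmodClosed.Build K L subalgb subalgb_closed.

Record lie_subalg : Type := LieSubalg {
  lie_subalg_val :> L;
  lie_subalg_valP : lie_subalg_val \in subalgb
}.

HB.instance Definition _ := [isSub for lie_subalg_val].
HB.instance Definition _ := [Choice of lie_subalg by <:].
HB.instance Definition _ := [SubChoice_isSubLmodule of lie_subalg by <:].

Lemma subalg_lieP (x y : lie_subalg) : [lie val x, val y] \in subalgb.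
Proof.
have /asboolP Sx := lie_subalg_valP x.
have /asboolP Sy := lie_subalg_valP y.
exact/asboolP/sg_lie.
Qed.

Definition sub_bracket (x y : lie_subalg) : lie_subalg :=
  LieSubalg (subalg_lieP x y).

Lemma sub_lieDl x y z :
  sub_bracket (x + y) z = sub_bracket x z + sub_bracket y z.
Proof. by apply: val_inj; rewrite /= lieDl. Qed.

Lemma sub_lieZl (c : K) x y : sub_bracket (c *: x) y = c *: sub_bracket x y.
Proof. by apply: val_inj; rewrite /= lieZl. Qed.

Lemma sub_lieDr x y z :
  sub_bracket x (y + z) = sub_bracket x y + sub_bracket x z.
Proof. by apply: val_inj; rewrite /= lieDr. Qed.

Lemma sub_lieZr (c : K) x y : sub_bracket x (c *: y) = c *: sub_bracket x y.
Proof. by apply: val_inj; rewrite /= lieZr. Qed.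

Lemma sub_liexx x : sub_bracket x x = 0.
Proof. by apply: val_inj; rewrite /= liexx. Qed.

Lemma sub_jacobi x y z :
  sub_bracket x (sub_bracket y z) + sub_bracket y (sub_bracket z x)
  + sub_bracket z (sub_bracket x y) = 0.
Proof. by apply: val_inj; rewrite /= lie_jacobi. Qed.

HB.instance Definition _ := Lmodule_isLie.Build K lie_subalg
  sub_lieDl sub_lieZl sub_lieDr sub_lieZr sub_liexx sub_jacobi.

End LieSubalgebra.

Section Forms.
Variable n : nat.

Definition basis_vec (i : 'I_n) : 'rV[int]_n := delta_mx 0 i.

(* Only the entries of a strictly above the diagonal matter. *)
Definition unit_form (a : 'M[int]_n) (x : 'rV[int]_n) : int :=
  \sum_i x 0 i ^+ 2
  + \sum_(i < n) \sum_(j < n | (i < j)%N) a i j * x 0 i * x 0 j.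

Definition form_connected (a : 'M[int]_n) : Prop :=
  forall i j, connect [rel i j | (i != j) && (a i j != 0)] i j.

Variable q : 'rV[int]_n -> int.

Definition polar (x y : 'rV[int]_n) : int := q (x + y) - q x - q y.

Definition weakly_positive : Prop :=
  forall x : 'rV[int]_n, x != 0 -> (forall i, 0 <= x 0 i) -> 0 < q x.

Definition pos_semidefinite : Prop := forall x, 0 <= q x.

Fixpoint is_root (s : seq 'I_n) : bool :=
  match s with
  | [::] => false
  | [:: _] => true
  | i :: s' =>
      (polar (basis_vec i) (\sum_(j <- s') basis_vec j) == -1) && is_root s'
  end.

End Forms.

Section FormLie.
Variables (K : fieldType) (n : nat) (q : 'rV[int]_n -> int).

(* Being a root is a property of the index sequence, so the set is a set of
   values of brackets over sequences. The sequence s is nonempty as a root. *)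
Inductive non_root_bracket : free_lie K 'I_n -> Prop :=
| NonRootBracket i s : ~~ is_root q (i :: s) -> is_root q s ->
    non_root_bracket (multibracket [seq free_var j | j <- i :: s]).

Definition L_alg : lieAlgType K := lie_quot non_root_bracket.

(* GX false i is x_i and GX true i is x_(-i): the boolean e stands for the sign
   (-1) ^+ e. *)
Inductive G_gen : Type :=
| GX of bool & 'I_n
| GH of 'I_n.

Definition G_x (e : bool) (i : 'I_n) : free_lie K G_gen := free_var (GX e i).
Definition G_h (i : 'I_n) : free_lie K G_gen := free_var (GH i).

(* The relation u = v is encoded by the element u - v. *)
Inductive G_rel : free_lie K G_gen -> Prop :=
| G_rel1 i j : G_rel [lie G_h i, G_h j]
| G_rel2 i j e :
    G_rel ([lie G_h i, G_x e j]
           - ((-1) ^+ e * polar q (basis_vec i) (basis_vec j))%:~R *: G_x e j)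
| G_rel3 i e : G_rel ([lie G_x e i, G_x (~~ e) i] - (-1) ^+ e *: G_h i)
| G_rel4 (w : seq (bool * 'I_n)) :
    1 < q (\sum_(p <- w) (-1) ^+ p.1 *: basis_vec p.2) ->
    G_rel (multibracket [seq G_x p.1 p.2 | p <- w]).

Definition G_alg : lieAlgType K := lie_quot G_rel.

Inductive G_pos_gen : G_alg -> Prop :=
| GPosGen i : G_pos_gen (lie_pi G_rel (G_x false i)).

Definition G_plus : lieAlgType K := lie_subalg G_pos_gen.

End FormLie.

(* Main.v *)
Require Import Defs.
From HB Require Import structures.
From mathcomp Require Import all_boot all_order all_algebra reals complex.
From mathcomp Require Import generic_quotient ring_quotient boolp functions.
From mathcomp Require Import zify ring.

(** The map [v_i |-> x_i] induces a surjection [L_to_G_plus] from [L(q, r)] to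
    [G^+(q)].  It is well defined by weak positivity: if [u] is a root of weight
    [y], then [q y = 1] and [q (e_i + y) = 2 + <e_i, y>] is positive; so if
    [[v_i, u]] is not a root, this value exceeds 1 and the image of [[v_i, u]]
    is killed by the last relation of [G(q)] ([non_root_q_gt1]).  Injectivity
    is obtained by bounding the source from above and the target from below.

    Upper bound.  The algebra [L(q, r)] is graded by weights in [N^n], it is
    spanned by standard multibrackets, and those that are not roots vanish.  So
    only weights [x] with [q x = 1], the positive roots of [q], occur, and any
    bracket that lands in another weight is zero.  Each weight space is at most
    a line ([weight_space_line]).  Indeed let [e_i] and [e_j] be in the support
    of [x] with [<e_i, x> = <e_j, x> = 1]; the brackets of weight [x] that begin
    with [v_i] also begin with [v_j] ([simple_split_posroot]).  If [a_ij = -1],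
    then [x = e_i + e_j]; if [a_ij = 0], then [v_i] and [v_j] commute.  If
    [a_ij = 1], then [y = x - e_i - e_j] satisfies [q y = 2] and is the sum of
    two orthogonal positive roots [al] and [be] ([orthogonal_split]), each of
    which pairs to [-1] with both [e_i] and [e_j].  By induction an element of
    weight [x - e_i] is [[a, [v_j, b]]] with [a], [b] of weights [al], [be], and
    the Jacobi identity turns [[v_i, [a, [v_j, b]]]] into [[v_j, [[v_i, a], b]]],
    the other terms having weights of value 2.

    Lower bound.  Let [B] be biadditive with [q x = B x x].  The twisted loop
    algebra of [q] has an element [E a] of degree [a] for every [a] with
    [q a = 1] and, in every degree [g] with [q g = 0], elements [T h g], where
    [h] is taken modulo the radical of [q]; its brackets carry the signs
    [(-1)^(B a b)].  As [q] is positive semi-definite, isotropic vectors lie in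
    the radical, and this makes the Jacobi identity hold.  It is realized here
    by operators on its own completed adjoint representation, so that only
    commutators of pairs of elements have to be computed ([lie_real_real],
    [lie_real_imag], [lie_imag_imag]).  Its degrees have [q]-value 0 or 1, hence
    it satisfies all the relations of [G(q)] ([G_rel_loop]).  The image of a
    root of weight [x] is a nonzero multiple of [E x]
    ([loop_root_multibracket]), and the [E x] are linearly independent.  So no
    combination of roots of distinct weights vanishes in [G^+(q)]
    ([weight_injective]). *)

Set Implicit Arguments.
Unset Strict Implicit.
Unset Printing Implicit Defensive.
Import Order.TTheory GRing.Theory Num.Theory.
Local Open Scope ring_scope.

(** * Homomorphisms out of presented Lie algebras *)

Section UniversalProperties.
Variable K : fieldType.

Section LieTheory.
Variable L : lieAlgType K.
Implicit Types x y z : L.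

Lemma lie0r x : [lie x, 0] = 0.
Proof. by have := lieZr 0 x 0; rewrite !scale0r. Qed.

Lemma lie0l x : [lie 0, x] = 0.
Proof. by have := lieZl 0 0 x; rewrite !scale0r. Qed.

Lemma lieNr x y : [lie x, - y] = - [lie x, y].
Proof. by rewrite -scaleN1r lieZr scaleN1r. Qed.

Lemma lie_leibniz x y z :
  [lie x, [lie y, z]] = [lie [lie x, y], z] + [lie y, [lie x, z]].
Proof.
have := lie_jacobi x y z; rewrite (lie_anti z x) lieNr (lie_anti z [lie x, y]).
by move/eqP; rewrite -addrA addr_eq0 opprD !opprK addrC => /eqP.
Qed.

End LieTheory.

Definition lie_morphism (L M : lieAlgType K) (f : L -> M) : Prop :=
  [/\ forall x y, f (x + y) = f x + f y, forall c x, f (c *: x) = c *: f x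
    & forall x y, f [lie x, y] = [lie f x, f y]].

Section Morphism.
Variables (L M : lieAlgType K) (f : L -> M).
Hypothesis fM : lie_morphism f.

Lemma lie_morph0 : f 0 = 0.
Proof. by case: fM => _ fZ _; rewrite -[in LHS](scale0r 0) fZ scale0r. Qed.

Lemma lie_morphB x y : f (x - y) = f x - f y.
Proof. by case: fM => fD fZ _; rewrite fD -scaleN1r fZ scaleN1r. Qed.

Lemma lie_morph_multibracket s :
  f (multibracket s) = multibracket [seq f x | x <- s].
Proof.
case: fM => _ _ fL; elim: s => [|x [|y s] IH] //=; first exact: lie_morph0.
by rewrite fL IH.
Qed.

Lemma lie_morph_ideal (S : L -> Prop) x :
  (forall y, S y -> f y = 0) -> ideal_gen S x -> f x = 0.
Proof.
case: fM => fD fZ fL fS; elim=> {x} [//||x y _ fx _ fy|c x _ fx|x y _ fy].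
- exact: lie_morph0.
- by rewrite fD fx fy addr0.
- by rewrite fZ fx scaler0.
- by rewrite fL fy lie0r.
Qed.

End Morphism.

Section FreeLift.
Variables (X : Type) (L : lieAlgType K) (g : X -> L).

Fixpoint term_eval (t : lie_term K X) : L :=
  match t with
  | LVar x => g x
  | LZero => 0
  | LAdd s t => term_eval s + term_eval t
  | LScale c t => c *: term_eval t
  | LLie s t => [lie term_eval s, term_eval t]
  end.

Lemma term_eval_cong s t : lie_cong s t -> term_eval s = term_eval t.
Proof.
elim=> {s t} /=; try by move=> *; congruence.
- by move=> s t u; rewrite addrA.
- by move=> s t; rewrite addrC.
- by move=> s; rewrite add0r.
- by move=> s; rewrite scaleN1r addNr.
- by move=> b c s; rewrite scalerA.
- by move=> s; rewrite scale1r.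
- by move=> c s t; rewrite scalerDr.
- by move=> b c s; rewrite scalerDl.
- by move=> s t u; rewrite lieDl.
- by move=> c s t; rewrite lieZl.
- by move=> s t u; rewrite lieDr.
- by move=> c s t; rewrite lieZr.
- by move=> s; rewrite liexx.
- by move=> s t u; rewrite lie_jacobi.
Qed.

Definition free_lift (x : free_lie K X) : L := term_eval (repr x).

Lemma free_lift_pi t : free_lift (free_pi t) = term_eval t.
Proof. exact/term_eval_cong/free_lie_repr. Qed.

Lemma free_lift_var x : free_lift (free_var x) = g x.
Proof. by rewrite /free_var free_lift_pi. Qed.

Lemma free_lift_morphism : lie_morphism free_lift.
Proof.
split.
- move=> x y; elim/free_pi_ind: x => s; elim/free_pi_ind: y => t.
  by rewrite [free_pi s + _]free_addE !free_lift_pi.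
- move=> c x; elim/free_pi_ind: x => s.
  by rewrite [c *: free_pi s]free_scaleE !free_lift_pi.
- move=> x y; elim/free_pi_ind: x => s; elim/free_pi_ind: y => t.
  by rewrite [[lie free_pi s, _]]free_bracketE !free_lift_pi.
Qed.

End FreeLift.

Section QuotLift.
Variables (L M : lieAlgType K) (S : L -> Prop) (f : L -> M).
Hypotheses (fM : lie_morphism f) (fS : forall x, S x -> f x = 0).

Definition quot_lift (x : lie_quot S) : M := f (repr x).

Lemma quot_lift_pi x : quot_lift (lie_pi S x) = f x.
Proof.
apply/eqP; rewrite -subr_eq0 -(lie_morphB fM); apply/eqP.
by apply: (lie_morph_ideal fM fS); exact: lie_pi_repr.
Qed.

Lemma lie_pi_morphism : lie_morphism (lie_pi S).
Proof.
split; [exact: lie_piD | exact: lie_piZ |].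
by move=> x y; rewrite -lq_bracketE.
Qed.

Lemma quot_lift_morphism : lie_morphism quot_lift.
Proof.
have [piD piZ piL] := lie_pi_morphism; have [fD fZ fL] := fM.
split.
- move=> x y; elim/lie_pi_ind: x => x; elim/lie_pi_ind: y => y.
  by rewrite -piD !quot_lift_pi fD.
- by move=> c x; elim/lie_pi_ind: x => x; rewrite -piZ !quot_lift_pi fZ.
- move=> x y; elim/lie_pi_ind: x => x; elim/lie_pi_ind: y => y.
  by rewrite -piL !quot_lift_pi fL.
Qed.

End QuotLift.
End UniversalProperties.

(** * Integral quadratic forms *)

Definition biadditive (U V W : zmodType) (B : U -> V -> W) : Prop :=
  (forall x y z, B (x + y) z = B x z + B y z) /\
  (forall x y z, B x (y + z) = B x y + B x z).

Section QuadraticForm.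
(* An integral form has a biadditive B with q x = B x x, but in general no
   symmetric one with integral values. *)
Variables (n : nat) (q : 'rV[int]_n -> int) (B : 'rV[int]_n -> 'rV[int]_n -> int).
Hypotheses (B_biadd : biadditive B) (qB : forall x, q x = B x x).
Local Notation "<< x , y >>" := (polar q x y).
Local Notation e := (@basis_vec n).

Lemma polarE x y : <<x, y>> = B x y + B y x.
Proof. by case: B_biadd => BDl BDr; rewrite /polar !qB BDl !BDr; ring. Qed.

Lemma polarDl x y z : <<x + y, z>> = <<x, z>> + <<y, z>>.
Proof. by case: B_biadd => BDl BDr; rewrite !polarE BDl BDr; ring. Qed.

Lemma polarC x y : <<x, y>> = <<y, x>>.
Proof. by rewrite !polarE addrC. Qed.

Lemma polarDr x y z : <<x, y + z>> = <<x, y>> + <<x, z>>.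
Proof. by rewrite !(polarC x) polarDl. Qed.

Lemma polar0l x : <<0, x>> = 0.
Proof. by apply: (addrI <<0, x>>); rewrite -polarDl !addr0. Qed.

Lemma polar0r x : <<x, 0>> = 0.
Proof. by rewrite polarC polar0l. Qed.

Lemma polarNl x y : <<- x, y>> = - <<x, y>>.
Proof. by apply: (addrI <<x, y>>); rewrite -polarDl !subrr polar0l. Qed.

Lemma polarNr x y : <<x, - y>> = - <<x, y>>.
Proof. by rewrite !(polarC x) polarNl. Qed.

Lemma polarBr x y z : <<x, y - z>> = <<x, y>> - <<x, z>>.
Proof. by rewrite polarDr polarNr. Qed.

Lemma polarxx x : <<x, x>> = q x *+ 2.
Proof. by rewrite polarE -qB mulr2n. Qed.

Lemma qD x y : q (x + y) = q x + q y + <<x, y>>.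
Proof. by rewrite /polar; ring. Qed.

Lemma qN x : q (- x) = q x.
Proof.
have := polarxx (- x); rewrite polarNl polarNr opprK polarxx => E.
by lia.
Qed.

Lemma qB_sub x y : q (x - y) = q x + q y - <<x, y>>.
Proof. by rewrite qD qN polarNr. Qed.

Lemma q_0 : q 0 = 0.
Proof. by have := polarxx 0; rewrite polar0l => E; lia. Qed.

Lemma polar_coord z x : <<z, x>> = \sum_i x 0 i * <<z, e i>>.
Proof.
rewrite [in LHS](row_sum_delta x) (big_morph (polar q z) (polarDr z) (polar0r z)).
apply: eq_bigr => i _; rewrite -/(basis_vec i).
have polarMn m : <<z, e i *+ m>> = m%:Z * <<z, e i>>.
  elim: m => [|m IH]; first by rewrite mulr0n polar0r mul0r.
  by rewrite mulrS polarDr IH; lia.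
have -> : x 0 i *: e i = e i *~ x 0 i by rewrite -scaler_int intz.
by case: (x 0 i) => m; rewrite /intmul ?polarNr polarMn; lia.
Qed.

(** ** Weakly positive forms *)

Hypotheses (q_basis : forall i, q (e i) = 1) (q_wpos : weakly_positive q).

Definition nonneg (x : 'rV[int]_n) : Prop := forall i, 0 <= x 0 i.
Definition height (x : 'rV[int]_n) : int := \sum_i x 0 i.
Definition posroot (x : 'rV[int]_n) : Prop := nonneg x /\ q x = 1.

Lemma nonnegD x y : nonneg x -> nonneg y -> nonneg (x + y).
Proof. by move=> x0 y0 i; rewrite mxE addr_ge0. Qed.

Lemma basisE i j : e i 0 j = (j == i)%:Z.
Proof. by rewrite /basis_vec mxE eqxx; case: eqP. Qed.

Lemma nonneg_basis i : nonneg (e i).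
Proof. by move=> j; rewrite basisE. Qed.

Lemma posroot_basis i : posroot (e i).
Proof. by split; [exact: nonneg_basis | exact: q_basis]. Qed.

Lemma nonneg_sub_basis x i : nonneg x -> 1 <= x 0 i -> nonneg (x - e i).
Proof. by move=> x0 xi j; have := x0 j; rewrite !mxE eqxx; case: eqP => [->|] /=; lia. Qed.

Lemma heightD x y : height (x + y) = height x + height y.
Proof. by rewrite -big_split; apply: eq_bigr => i _; rewrite mxE. Qed.

Lemma height_basis i : height (e i) = 1.
Proof.
rewrite /height (bigD1 i) //= basisE eqxx big1 ?addr0 // => j /negPf ji.
by rewrite basisE ji.
Qed.

Lemma height_ge0 x : nonneg x -> 0 <= height x.
Proof. by move=> x0; apply: sumr_ge0 => i _. Qed.

Lemma height_gt0 x : nonneg x -> x != 0 -> 0 < height x.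
Proof.
move=> x0 xN0; rewrite lt_def height_ge0 // andbT; apply: contra xN0.
rewrite psumr_eq0 // => /allP h; apply/eqP/rowP=> i; rewrite mxE.
by apply/eqP/h/mem_index_enum.
Qed.

Lemma q_gt0 x : nonneg x -> x != 0 -> 1 <= q x.
Proof. by move=> x0 xN0; have := q_wpos xN0 x0; lia. Qed.

Lemma posroot_neq0 x : q x = 1 -> x != 0.
Proof. by move=> qx; apply/eqP=> x0; rewrite x0 q_0 in qx. Qed.

Lemma addr_nonneg_neq0 x y : nonneg x -> nonneg y -> x != 0 -> x + y != 0.
Proof.
move=> x0 y0 xN0; apply/eqP => /(congr1 height); rewrite heightD /height.
rewrite [RHS]big1 => [|i _]; last by rewrite mxE.
by have := height_gt0 x0 xN0; have := height_ge0 y0; rewrite /height; lia.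
Qed.

(** A smaller value would make the nonzero nonnegative vector [x + y] isotropic
    or of negative [q]-value. *)
Lemma polar_ge x y : posroot x -> posroot y -> -1 <= <<x, y>>.
Proof.
move=> [x0 qx] [y0 qy].
have := q_gt0 (nonnegD x0 y0) (addr_nonneg_neq0 x0 y0 (posroot_neq0 qx)).
by rewrite qD qx qy; lia.
Qed.

Lemma posrootD x y : posroot x -> posroot y -> <<x, y>> = -1 -> posroot (x + y).
Proof.
move=> [x0 qx] [y0 qy] xy; split; first exact: nonnegD.
by rewrite qD qx qy xy.
Qed.

Lemma polar_gt0_coord z x : nonneg x -> 0 < <<z, x>> ->
  exists i, 1 <= x 0 i /\ 1 <= <<z, e i>>.
Proof.
move=> x0 zx; apply: contrapT => noi.
suff: <<z, x>> <= 0 by lia.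
rewrite polar_coord; apply: sumr_le0 => i _.
have [xi|xi] := leP 1 (x 0 i); last by (suff -> : x 0 i = 0 by rewrite mul0r); have := x0 i; lia.
rewrite mulr_ge0_le0 //; have [] := leP 1 <<z, e i>>; last by lia.
by move=> zi; case: noi; exists i.
Qed.

Lemma polar_lt0_coord z x : nonneg x -> <<z, x>> < 0 ->
  exists i, 1 <= x 0 i /\ <<z, e i>> <= -1.
Proof.
move=> x0 zx; have [|i [xi zi]] := @polar_gt0_coord (- z) x x0.
  by rewrite polarNl; lia.
by exists i; split=> //; rewrite polarNl in zi; lia.
Qed.

Lemma isotropic_nonneg x : nonneg x -> q x = 0 -> x = 0.
Proof. by move=> x0 qx; apply/eqP/negPn/negP=> /(q_gt0 x0); rewrite qx. Qed.

Lemma posroot_sub_basis x i : posroot x -> 1 <= x 0 i -> <<e i, x>> = 1 ->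
  posroot (x - e i).
Proof.
move=> [x0 qx] xi ix; split; first exact: nonneg_sub_basis.
by rewrite qB_sub qx q_basis polarC ix.
Qed.

(** As [<x, x> = 2] is the sum of the [x_i * <e_i, x>], some [e_i] in the support
    of [x] pairs positively with [x]; if the value exceeds 1, then [x - e_i] is
    not of positive [q]-value, hence zero. *)
Lemma posroot_descent x : posroot x ->
  exists i, 1 <= x 0 i /\ (x = e i \/ <<e i, x>> = 1).
Proof.
move=> [x0 qx].
have [|i [xi ix]] := @polar_gt0_coord x x x0; first by rewrite polarxx qx.
exists i; split=> //; have xi0 := nonneg_sub_basis x0 xi.
have [/subr0_eq xE|xN] := eqVneq (x - e i) 0; first by left.
right; have := q_gt0 xi0 xN; rewrite qB_sub qx q_basis.
by rewrite (polarC (e i)); lia.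
Qed.

(** Take for [x] a positive root of maximal height below [y].  No basis vector in
    the support of [y - x] pairs to [-1] with [x], since it could be added to [x];
    so [<x, y - x> >= 0], and [2 = 1 + q (y - x) + <x, y - x>] leaves only
    [q (y - x) = 1]. *)
Lemma orthogonal_split y : nonneg y -> q y = 2 ->
  exists x z, [/\ posroot x, posroot z, y = x + z & <<x, z>> = 0].
Proof.
move=> y0 qy.
have [|i [yi _]] := @polar_gt0_coord y y y0; first by rewrite polarxx qy.
have: exists2 x, posroot x & nonneg (y - x).
  by exists (e i); [exact: posroot_basis | exact: nonneg_sub_basis].
case=> x rx xy.
have [m] : exists m : nat, height (y - x) <= m%:Z.
  by exists `|height (y - x)|%N; have := height_ge0 xy; lia.
elim: m x rx xy => [|m IH] x rx xy hm.
  have: y - x != 0 by rewrite subr_eq0; apply/eqP=> E; move: rx.2; rewrite -E qy.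
  by move/(height_gt0 xy); lia.
have yxN0 : y - x != 0.
  by rewrite subr_eq0; apply/eqP=> E; move: rx.2; rewrite -E qy.
have qyx := q_gt0 xy yxN0.
have yE : y = x + (y - x) by rewrite addrC subrK.
have qE : 2 = 1 + q (y - x) + <<x, y - x>> by have := qD x (y - x); rewrite -yE qy rx.2.
have [xlt|xge] := ltP <<x, y - x>> 0; last first.
  by exists x, (y - x); split=> //; [split=> //; lia | lia].
have [j [yj xj]] := polar_lt0_coord xy xlt.
have xj1 : <<x, e j>> = -1 by have := polar_ge rx (posroot_basis j); lia.
apply: (IH (x + e j)).
- exact: posrootD (posroot_basis j) xj1.
- by rewrite opprD addrA; exact: nonneg_sub_basis.
have : height (y - x) = height (y - (x + e j)) + height (e j).
  by rewrite -heightD opprD addrA subrK.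
by rewrite height_basis; lia.
Qed.

(** * One-dimensional weight spaces of the quotient of the free Lie algebra *)

Section WeightSpaces.
Variable K : fieldType.
Hypothesis polar_basis : forall i j, i != j -> -1 <= <<e i, e j>> <= 1.
Local Notation L := (L_alg K q).
Local Notation piL := (lie_pi (@non_root_bracket K n q)).

Definition L_gen (i : 'I_n) : L := piL (free_var i).
Definition L_br (s : seq 'I_n) : L := multibracket [seq L_gen i | i <- s].
Definition weight (s : seq 'I_n) : 'rV[int]_n := \sum_(i <- s) e i.

Inductive weight_space (x : 'rV[int]_n) : L -> Prop :=
| ws_br s : weight s = x -> weight_space x (L_br s)
| ws_0 : weight_space x 0
| ws_add u w : weight_space x u -> weight_space x w -> weight_space x (u + w)
| ws_scale c u : weight_space x u -> weight_space x (c *: u).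

Lemma L_brE s : L_br s = piL (multibracket [seq free_var i | i <- s]).
Proof. by rewrite (lie_morph_multibracket (lie_pi_morphism _)) -map_comp. Qed.

Lemma L_br_cons i j s : L_br (i :: j :: s) = [lie L_gen i, L_br (j :: s)].
Proof. by []. Qed.

Lemma weight_cons i s : weight (i :: s) = e i + weight s.
Proof. exact: big_cons. Qed.

Lemma weight_nonneg s : nonneg (weight s).
Proof.
elim: s => [|i s IH]; first by move=> i; rewrite /weight big_nil mxE.
by rewrite weight_cons; apply: nonnegD IH; exact: nonneg_basis.
Qed.

Lemma height_weight s : height (weight s) = (size s)%:Z.
Proof.
elim: s => [|i s IH].
  by rewrite /weight big_nil /height big1 // => i _; rewrite mxE.
by rewrite weight_cons heightD height_basis IH /=; lia.
Qed.

Lemma weight_space_gen i : weight_space (e i) (L_gen i).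
Proof. by apply: (@ws_br _ [:: i]); rewrite /weight big_seq1. Qed.

(** Brackets of standard multibrackets are combinations of standard ones, by
    [[[v_i, b], w] = [v_i, [b, w]] - [b, [v_i, w]]]. *)
Lemma weight_space_lie x y u w :
  weight_space x u -> weight_space y w -> weight_space (x + y) [lie u, w].
Proof.
have gen i z v : weight_space z v -> weight_space (e i + z) [lie L_gen i, v].
  elim=> {v} [[|j s] <-||u1 u2 _ IH1 _ IH2|c u1 _ IH].
  - by rewrite /L_br /= lie0r; apply: ws_0.
  - by rewrite -L_br_cons; apply: ws_br; rewrite weight_cons.
  - by rewrite lie0r; apply: ws_0.
  - by rewrite lieDr; apply: ws_add.
  - by rewrite lieZr; apply: ws_scale.
move=> xu yw; elim: xu => {u} [s <-||u1 u2 _ IH1 _ IH2|c u1 _ IH].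
- elim: s y w yw => [|i [|j s] IH] y w yw.
  + by rewrite /L_br /= lie0l; apply: ws_0.
  + by rewrite /weight big_seq1; apply: gen.
  + have -> : [lie L_br [:: i, j & s], w] = [lie L_gen i, [lie L_br (j :: s), w]]
        + (-1) *: [lie L_br (j :: s), [lie L_gen i, w]].
      by rewrite (lie_leibniz (L_gen i)) scaleN1r addrK.
    apply: ws_add; first by rewrite weight_cons -addrA; apply/gen/IH.
    apply: ws_scale; rewrite weight_cons (addrC (e i)) -addrA.
    exact/IH/gen.
- by rewrite lie0l; apply: ws_0.
- by rewrite lieDl; apply: ws_add.
- by rewrite lieZl; apply: ws_scale.
Qed.

Lemma q_weight_root s : is_root q s -> q (weight s) = 1.
Proof.
elim: s => [|i [|j s] IH] //; first by rewrite /weight big_seq1 q_basis.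
rewrite weight_cons => /andP[/eqP ij /IH qs].
by rewrite qD q_basis qs -/(weight _) in ij *; rewrite ij.
Qed.

(** The longest suffix of [s] that is a root, together with the letter before it,
    is a generator of the ideal. *)
Lemma L_br_nonroot s : ~~ is_root q s -> L_br s = 0.
Proof.
elim: s => [|i [|j s] IH] // r.
have [rs|rs] := boolP (is_root q (j :: s)).
  rewrite L_brE -(lie_pi0 (@non_root_bracket K n q)); apply/lie_piP.
  by rewrite subr0; apply: ig_mem; constructor.
by rewrite L_br_cons IH // lie0r.
Qed.

Lemma weight_space_eq0 x u : weight_space x u -> q x != 1 -> u = 0.
Proof.
elim=> {u} [s <-|//|u w _ IHu _ IHw|c u _ IH] qx.
- by apply: L_br_nonroot; apply: contra qx => /q_weight_root ->.
- by rewrite IHu // IHw // addr0.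
- by rewrite IH // scaler0.
Qed.

Lemma weight_space_basis i u : weight_space (e i) u -> exists c, u = c *: L_gen i.
Proof.
elim=> {u} [s sE||u w _ [c ->] _ [d ->]|c u _ [d ->]].
- have := height_weight s; rewrite sE height_basis.
  case: s sE => [|j [|k s]] //; rewrite /weight big_seq1 => ji _.
  exists 1; rewrite scale1r; congr L_gen; apply/eqP.
  by move: ji => /rowP/(_ i); rewrite !basisE eqxx eq_sym; case: eqP.
- by exists 0; rewrite scale0r.
- by exists (c + d); rewrite scalerDl.
- by exists (c * d); rewrite scalerA.
Qed.

(** The outermost letter of an element of weight [x] can be chosen freely among
    the [i] in the support of [x] with [<e_i, x> = 1].  This freedom is what makes
    weight spaces lines. *)
Definition simple_split (x : 'rV[int]_n) : Prop := forall i u,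
  1 <= x 0 i -> <<e i, x>> = 1 -> weight_space x u ->
  exists2 u', weight_space (x - e i) u' & u = [lie L_gen i, u'].

Definition root_split (x y : 'rV[int]_n) : Prop := forall u,
  weight_space (x + y) u ->
  exists a b, [/\ weight_space x a, weight_space y b & u = [lie a, b]].

Lemma simple_split_basisD i y : posroot y -> <<e i, y>> = -1 ->
  simple_split (e i + y) -> forall u, weight_space (e i + y) u ->
  exists2 u', weight_space y u' & u = [lie L_gen i, u'].
Proof.
move=> [y0 qy] iy H u /H -/(_ i).
rewrite polarDr polarxx q_basis iy [e i + y - e i]addrC addKr.
by apply=> //; rewrite mxE basisE eqxx lerDl; exact: y0.
Qed.

(** Peel a letter [k] off [x], so that [x = x' + e_k].  As [<e_k, y>] and
    [<x', y>] are at least [-1] and add up to [-1], one of them is [-1] and the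
    other is 0.  Brackets of weight [e_k + y] or [x' + y], whichever has value 2,
    vanish, and the Jacobi identity moves [v_k] next to the factor of weight
    [x']. *)
Lemma root_split_of_simple N :
  (forall x, posroot x -> height x <= N -> simple_split x) ->
  forall x y, posroot x -> posroot y -> <<x, y>> = -1 -> height (x + y) <= N ->
  root_split x y.
Proof.
move=> H x y; have [m] : exists m : nat, height x <= m%:Z.
  by exists `|height x|%N; lia.
elim: m x y => [|m IH] x y hm rx ry xy hN u xyu.
  by have := height_gt0 rx.1 (posroot_neq0 rx.2); lia.
have [k [xk [xE|kx]]] := posroot_descent rx.
  move: xy hN xyu; rewrite xE => ky hN kyu.
  have [|u' yu' ->] := simple_split_basisD ry ky _ kyu.
    by apply: H => //; exact: posrootD (posroot_basis k) ry ky.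
  by exists (L_gen k), u'; split=> //; exact: weight_space_gen.
have rx' := posroot_sub_basis rx xk kx; set x' := x - e k in rx'.
have xE : x = x' + e k by rewrite subrK.
have hx : height x = height x' + 1 by rewrite xE heightD height_basis.
have kx' : <<e k, x'>> = -1 by rewrite polarBr polarxx q_basis kx.
clearbody x'.
have k_ge := polar_ge (posroot_basis k) ry.
have x'_ge := polar_ge rx' ry.
have kxy : <<x', y>> + <<e k, y>> = -1 by rewrite -polarDl -xE.
have [ky|ky] : <<e k, y>> = -1 \/ <<e k, y>> = 0 by lia.
- have ry' := posrootD (posroot_basis k) ry ky.
  have hxy : height x' + height (e k + y) <= N.
    by rewrite -heightD addrA -xE.
  have x'_gt := height_gt0 rx'.1 (posroot_neq0 rx'.2).
  have [||||a [b' [x'a kyb' ->]]] := IH x' (e k + y) _ rx' ry' _ _ u.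
  + by lia.
  + by rewrite polarDr (polarC x') kx'; lia.
  + by rewrite heightD.
  + by rewrite addrA -xE.
  have [|b yb ->] := simple_split_basisD ry ky _ kyb'.
    by apply: H => //; lia.
  have ab : [lie a, b] = 0.
    by apply: weight_space_eq0 (weight_space_lie x'a yb) _; rewrite qD rx'.2 ry.2; lia.
  exists [lie a, L_gen k], b; rewrite lie_leibniz ab lie0r addr0 xE; split=> //.
  by apply: weight_space_lie => //; exact: weight_space_gen.
have x'y : <<x', y>> = -1 by lia.
have rx'y := posrootD rx' ry x'y.
have xyE : x + y = e k + (x' + y) by rewrite xE [x' + e k]addrC addrA.
have kx'y : <<e k, x' + y>> = -1 by rewrite polarDr kx' ky.
rewrite xyE in xyu hN.
have [|u' x'yu' ->] := simple_split_basisD rx'y kx'y _ xyu.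
  by apply: H => //; exact: posrootD (posroot_basis k) rx'y kx'y.
have [||a [b [x'a yb ->]]] := IH x' y _ rx' ry x'y _ u' x'yu'.
- by lia.
- by move: hN; rewrite heightD height_basis; lia.
have kb : [lie L_gen k, b] = 0.
  apply: weight_space_eq0 (weight_space_lie (weight_space_gen k) yb) _.
  by rewrite qD q_basis ry.2 ky.
exists [lie L_gen k, a], b; rewrite lie_leibniz kb lie0r addr0 xE [x' + _]addrC.
by split=> //; apply: weight_space_lie => //; exact: weight_space_gen.
Qed.

Lemma basis_weight_br x i s : weight (i :: s) = x -> weight_space (x - e i) (L_br s).
Proof. by move=> <-; rewrite weight_cons addrC addKr; apply: ws_br. Qed.

(** By induction on the height of [x], it suffices to rewrite a bracket that
    begins with [i] as one that begins with [j].  The three cases are the values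
    of [<e_i, e_j>]. *)
Lemma simple_split_posroot x : posroot x -> simple_split x.
Proof.
have [m] : exists m : nat, height x <= m%:Z by exists `|height x|%N; lia.
elim: m x => [|m IH] x hm rx.
  by have := height_gt0 rx.1 (posroot_neq0 rx.2); lia.
have split_lt := root_split_of_simple (fun x rx hx => IH x hx rx).
move=> j u xj jx; have [x0 qx] := rx.
elim=> {u} [s sx||u w _ [u' xu ->] _ [w' xw ->]|c u _ [u' xu ->]]; last 1 first.
- by exists (c *: u'); [exact: ws_scale | rewrite lieZr].
- case: s sx => [|i [|k s]] sx.
  + by exists 0; [exact: ws_0 | rewrite lie0r].
  + move: sx jx xj; rewrite /weight big_seq1 => <-; rewrite basisE.
    by case: eqP => // ->; rewrite polarxx q_basis.
  have xu := basis_weight_br sx; rewrite L_br_cons.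
  have xE : x = (x - e i) + e i by rewrite subrK.
  set x' := x - e i in xu xE; set u := L_br _ in xu *.
  have [qx'|qx'] := eqVneq (q x') 1; last first.
    by exists 0; [exact: ws_0 | rewrite (weight_space_eq0 xu qx') !lie0r].
  have [ij|ij] := eqVneq i j; first by exists u; rewrite -?ij.
  have rx' : posroot x'.
    by split=> //; rewrite /x' -sx weight_cons addrC addKr; exact: weight_nonneg.
  have hx : height x' + 1 = height x by rewrite [in RHS]xE heightD height_basis.
  have ix : <<e i, x>> = 1.
    by have := qB_sub x (e i); rewrite -/x' qx' qx q_basis (polarC x); lia.
  have x'j : 1 <= x' 0 j.
    by rewrite !mxE eqxx eq_sym (negPf ij) subr0.
  have jx' : <<e j, x'>> = 1 - <<e i, e j>> by rewrite polarBr jx [in RHS]polarC.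
  have := polar_basis ij; case/andP=> ij_ge ij_le.
  have ijC : <<e j, e i>> = <<e i, e j>> by rewrite polarC.
  have [aij|aij|aij] : [\/ <<e i, e j>> = -1, <<e i, e j>> = 0 | <<e i, e j>> = 1].
    case: (ltgtP <<e i, e j>> 0) => ?; [apply: Or31 | apply: Or33 | exact: Or32]; lia.
  + (* x' - e_j is nonnegative and isotropic, so x = e_i + e_j *)
    have x'jE : x' = e j.
      apply/eqP; rewrite -subr_eq0; apply/eqP/isotropic_nonneg.
        exact: nonneg_sub_basis rx'.1 x'j.
      by rewrite qB_sub qx' q_basis (polarC x') jx' aij.
    rewrite x'jE in xu; have [c ->] := weight_space_basis xu.
    exists ((- c) *: L_gen i).
      by rewrite xE x'jE addrC addKr; apply/ws_scale/weight_space_gen.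
    by rewrite !lieZr scaleNr (lie_anti (L_gen j)) scalerN opprK.
  + (* [v_i, v_j] has a weight of value 2, so bracketing with v_i and v_j commute *)
    have hx' : height x' <= m%:Z by lia.
    have [|w x'w ->] := IH _ hx' rx' j u x'j _ xu; first by rewrite jx' aij.
    have ijw : [lie L_gen i, L_gen j] = 0.
      apply: weight_space_eq0 (weight_space_lie (weight_space_gen i) (weight_space_gen j)) _.
      by rewrite qD !q_basis aij.
    exists [lie L_gen i, w]; last by rewrite lie_leibniz ijw lie0l add0r.
    rewrite xE addrAC addrC; apply: weight_space_lie x'w; exact: weight_space_gen.
  + (* x = e_i + e_j + al + be, where al and be are orthogonal to each other
       and both pair to -1 with e_i and e_j *)
    have y0 := nonneg_sub_basis rx'.1 x'j; set y := x' - e j in y0.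
    have qy : q y = 2 by rewrite qB_sub qx' q_basis (polarC x') jx' aij.
    have [al [be [ral rbe yE orth]]] := orthogonal_split y0 qy.
    have iy : <<e i, al>> + <<e i, be>> = -2.
      by rewrite -polarDr -yE !polarBr ix polarxx q_basis aij.
    have jy : <<e j, al>> + <<e j, be>> = -2.
      by rewrite -polarDr -yE polarBr jx' polarxx q_basis aij.
    have := polar_ge (posroot_basis i) ral; have := polar_ge (posroot_basis i) rbe.
    have := polar_ge (posroot_basis j) ral; have := polar_ge (posroot_basis j) rbe.
    move=> jbe_ge jal_ge ibe_ge ial_ge.
    have [ial ibe] : <<e i, al>> = -1 /\ <<e i, be>> = -1 by lia.
    have [jal jbe] : <<e j, al>> = -1 /\ <<e j, be>> = -1 by lia.
    have rjbe := posrootD (posroot_basis j) rbe jbe.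
    have x'E : x' = al + (e j + be) by rewrite addrCA -yE addrC subrK.
    have hx' : height x' <= m%:Z by lia.
    rewrite x'E in xu hx'.
    have [|a [b' [ala jbeb' ->]]] := split_lt al (e j + be) ral rjbe _ hx' u xu.
      by rewrite polarDr orth addr0 polarC.
    have [|b beb ->] := simple_split_basisD rbe jbe _ jbeb'.
      apply: IH => //; have := height_gt0 ral.1 (posroot_neq0 ral.2).
      by move: hx'; rewrite heightD; lia.
    have ijb : [lie L_gen i, [lie L_gen j, b]] = 0.
      apply: weight_space_eq0 (weight_space_lie (weight_space_gen i)
        (weight_space_lie (weight_space_gen j) beb)) _.
      by rewrite qD q_basis rjbe.2 polarDr aij ibe.
    have iaj : [lie [lie L_gen i, a], L_gen j] = 0.
      apply: weight_space_eq0 (weight_space_lie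
        (weight_space_lie (weight_space_gen i) ala) (weight_space_gen j)) _.
      by rewrite !qD !q_basis ral.2 polarDl aij ial (polarC al) jal.
    exists [lie [lie L_gen i, a], b].
      have -> : x - e j = (e i + al) + be.
        by apply/rowP=> l; rewrite xE x'E !mxE; ring.
      by apply: weight_space_lie => //; apply: weight_space_lie => //; exact: weight_space_gen.
    by rewrite lie_leibniz ijb lie0r addr0 lie_leibniz iaj lie0l add0r.
- by exists 0; [exact: ws_0 | rewrite lie0r].
- by exists (u' + w'); [exact: ws_add | rewrite lieDr].
Qed.

(** If all elements of weight [x] begin with the same letter [i], the weight space
    of [x] is the image of that of [x - e_i] under the bracket with [v_i]. *)
Lemma weight_space_line x u w : posroot x ->
  weight_space x u -> weight_space x w -> u != 0 -> exists c, w = c *: u.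
Proof.
have [m] : exists m : nat, height x <= m%:Z by exists `|height x|%N; lia.
elim: m x u w => [|m IH] x u w hm rx xu xw uN0.
  by have := height_gt0 rx.1 (posroot_neq0 rx.2); lia.
have [i [xi [xE|ix]]] := posroot_descent rx.
  rewrite xE in xu xw; have [c uE] := weight_space_basis xu.
  have [d ->] := weight_space_basis xw.
  have c0 : c != 0 by apply: contraNneq uN0 => c0; rewrite uE c0 scale0r.
  by exists (d / c); rewrite uE scalerA mulfVK.
have split := simple_split_posroot rx xi ix.
have [u' xu' uE] := split u xu; have [w' xw' ->] := split w xw.
have hx : height x = height (x - e i) + 1.
  by rewrite -(height_basis i) -heightD subrK.
have [||c ->] := IH (x - e i) u' w' _ (posroot_sub_basis rx xi ix) xu' xw'.
- by lia.
- by apply: contraNneq uN0 => u0; rewrite uE u0 lie0r.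
- by exists c; rewrite uE lieZr.
Qed.

Lemma weight_space_repr x : exists s, forall u, weight_space x u ->
  exists c, [/\ u = c *: L_br s & c != 0 -> is_root q s /\ weight s = x].
Proof.
have [[s [sx rs sN0]]|nos] :=
    pselect (exists s, [/\ weight s = x, is_root q s & L_br s != 0]).
  exists s => u xu; have [|c ->] := weight_space_line _ (ws_br sx) xu sN0.
    by split; [rewrite -sx; exact: weight_nonneg | rewrite -sx q_weight_root].
  by exists c.
have x0 u : weight_space x u -> u = 0.
  elim=> {u} [s sx|//|u w _ -> _ ->|c u _ ->]; rewrite ?addr0 ?scaler0 //.
  apply/eqP/negPn/negP=> sN0; case: nos; exists s; split=> //.
  by apply: contraNT sN0 => /L_br_nonroot ->.
by exists [::] => u /x0 ->; exists 0; rewrite scale0r eqxx.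
Qed.

Inductive weight_sum : L -> Prop :=
| wsum_mem x u : weight_space x u -> weight_sum u
| wsum_add u w : weight_sum u -> weight_sum w -> weight_sum (u + w).

Lemma weight_sum_lie u w : weight_sum u -> weight_sum w -> weight_sum [lie u, w].
Proof.
elim=> {u} [x u xu|u u' _ IH _ IH'] sw; last first.
  by rewrite lieDl; apply: wsum_add; [exact: IH | exact: IH'].
elim: sw => {w} [y w yw|w w' _ IH _ IH']; last by rewrite lieDr; apply: wsum_add.
exact: wsum_mem (weight_space_lie xu yw).
Qed.

Lemma weight_sum_total u : weight_sum u.
Proof.
have [piD piZ piL] := lie_pi_morphism (@non_root_bracket K n q).
elim/lie_pi_ind: u => y; elim/free_pi_ind: y => t; elim: t.
- by move=> i; exact: wsum_mem (weight_space_gen i).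
- have -> : free_pi LZero = 0 :> free_lie K 'I_n by [].
  by rewrite lie_pi0; exact: wsum_mem (ws_0 0).
- move=> s IHs t IHt; have -> : free_pi (LAdd s t) = free_pi s + free_pi t.
    by rewrite -free_addE.
  by rewrite piD; exact: wsum_add.
- move=> c s IHs; have -> : free_pi (LScale c s) = c *: free_pi s by rewrite -free_scaleE.
  rewrite piZ.
  elim: IHs => [x u xu|u w _ IHu _ IHw]; first exact/wsum_mem/ws_scale/xu.
  by rewrite scalerDr; exact: wsum_add.
- move=> s IHs t IHt; have -> : free_pi (LLie s t) = [lie free_pi s, free_pi t].
    by rewrite -free_bracketE.
  by rewrite piL; exact: weight_sum_lie.
Qed.

Lemma weight_decomposition u : exists (xs : seq 'rV[int]_n) (w : 'rV[int]_n -> L),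
  [/\ uniq xs, forall x, weight_space x (w x) & u = \sum_(x <- xs) w x].
Proof.
elim: (weight_sum_total u) => {u} [x u xu|_ _ _ [xs [u [uxs xu ->]]] _ [ys [w [uys yw ->]]]].
  exists [:: x], (fun y => if y == x then u else 0); rewrite big_seq1 eqxx; split=> // y.
  by case: eqP => [->|_] //; exact: ws_0.
exists (undup (xs ++ ys)),
  (fun x => (if x \in xs then u x else 0) + (if x \in ys then w x else 0)); split.
- exact: undup_uniq.
- by move=> x; apply: ws_add; case: ifP => _ //; exact: ws_0.
rewrite big_split -!big_mkcond /=; congr (_ + _); rewrite -[RHS]big_filter;
  apply: perm_big; apply: uniq_perm => //; rewrite ?filter_uniq ?undup_uniq // => x;
  by rewrite !(mem_filter, mem_undup, mem_cat) /=; case: (x \in xs); case: (x \in ys).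
Qed.

(** The functionals [coef x] separate the images of roots of distinct weights;
    as weight spaces are lines, this suffices for injectivity. *)
Lemma weight_injective (M : lieAlgType K) (f : L -> M)
    (coef : 'rV[int]_n -> {scalar M}) : lie_morphism f ->
  (forall x s, is_root q s -> (coef x (f (L_br s)) == 0) = (weight s != x)) ->
  forall u, f u = 0 -> u = 0.
Proof.
move=> fM coef_br u fu0; have [fD fZ _] := fM.
have [xs [w [uxs xw uE]]] := weight_decomposition u.
suff w0 x : x \in xs -> w x = 0 by rewrite uE big_seq big1.
move=> x_xs; have [s /(_ _ (xw x)) [c [wE cN0]]] := weight_space_repr x.
have [c0|/cN0 [rs sx]] := eqVneq c 0; first by rewrite wE c0 scale0r.
have coefw y : y != x -> coef x (f (w y)) = 0.
  move=> yx; have [t /(_ _ (xw y)) [d [-> dN0]]] := weight_space_repr y.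
  rewrite fZ linearZ /=; have [->|/dN0 [rt ty]] := eqVneq d 0; first by rewrite mul0r.
  by have /eqP -> : coef x (f (L_br t)) == 0; rewrite ?mulr0 // coef_br // ty.
have := congr1 (coef x) fu0; rewrite raddf0 uE (bigD1_seq x) //= fD raddfD.
rewrite (big_morph f fD (lie_morph0 fM)) raddf_sum big1 ?addr0; last by move=> y; exact: coefw.
rewrite wE fZ /= linearZ /= => /eqP; rewrite mulf_eq0 coef_br // sx eqxx orbF => /eqP ->.
by rewrite scale0r.
Qed.

End WeightSpaces.
End QuadraticForm.

(** * The Lie algebra of endomorphisms of a vector space *)

Section Endomorphisms.
Variables (K : fieldType) (V : lmodType K).

Definition linearb : pred (V -> V) := fun f => `[< linear f >].

Lemma linearb_closed : submod_closed linearb.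
Proof.
split=> [|c f g /asboolP fL /asboolP gL]; apply/asboolP=> d x y.
  by rewrite /= scaler0 addr0.
by rewrite /= !fctE fL gL !scalerDr !scalerA mulrC addrACA.
Qed.

HB.instance Definition _ := GRing.isSubmodClosed.Build K (V -> V) linearb linearb_closed.

Record endo : Type := Endo { endo_fun :> V -> V; endo_funP : endo_fun \in linearb }.

HB.instance Definition _ := [isSub for endo_fun].
HB.instance Definition _ := [Choice of endo by <:].
HB.instance Definition _ := [SubChoice_isSubLmodule of endo by <:].

Lemma endo_linear (f : endo) : linear f.
Proof. by have /asboolP := endo_funP f. Qed.

HB.instance Definition _ (f : endo) := GRing.isLinear.Build K V V *:%R f (endo_linear f).

Lemma commutator_linear (f g : endo) : (fun x => f (g x) - g (f x)) \in linearb.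
Proof.
apply/asboolP=> c x y; rewrite !linearP.
by rewrite /= scalerDr addrACA.
Qed.

Definition commutator (f g : endo) : endo := Endo (commutator_linear f g).

Lemma endoP (f g : endo) : (forall x, f x = g x) -> f = g.
Proof. by move=> fg; apply/val_inj/funext. Qed.

Lemma endoDE (f g : endo) x : (f + g) x = f x + g x. Proof. by []. Qed.
Lemma endoZE c (f : endo) x : (c *: f) x = c *: f x. Proof. by []. Qed.
Lemma endo0E x : (0 : endo) x = 0. Proof. by []. Qed.
Lemma commutatorE f g x : commutator f g x = f (g x) - g (f x). Proof. by []. Qed.

Lemma commutatorDl f g h : commutator (f + g) h = commutator f h + commutator g h.
Proof. by apply: endoP => x; rewrite !(commutatorE, endoDE) linearD opprD addrACA. Qed.

Lemma commutatorZl c f g : commutator (c *: f) g = c *: commutator f g.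
Proof. by apply: endoP => x; rewrite !(commutatorE, endoZE) linearZ scalerBr. Qed.

Lemma commutatorDr f g h : commutator f (g + h) = commutator f g + commutator f h.
Proof. by apply: endoP => x; rewrite !(commutatorE, endoDE) linearD opprD addrACA. Qed.

Lemma commutatorZr c f g : commutator f (c *: g) = c *: commutator f g.
Proof. by apply: endoP => x; rewrite !(commutatorE, endoZE) linearZ scalerBr. Qed.

Lemma commutatorxx f : commutator f f = 0.
Proof. by apply: endoP => x; rewrite commutatorE subrr. Qed.

Lemma commutator_jacobi f g h :
  commutator f (commutator g h) + commutator g (commutator h f)
  + commutator h (commutator f g) = 0.
Proof.
apply: endoP => x; rewrite !(endoDE, commutatorE, linearB) endo0E /=.
rewrite !opprK (AC ((2*2)*(2*2)*(2*2)) ((1*11)*(2*8)*(3*5)*(4*10)*(6*12)*(7*9))).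
by rewrite /= !subrr !addNr !addr0.
Qed.

HB.instance Definition _ := Lmodule_isLie.Build K endo commutatorDl commutatorZl
  commutatorDr commutatorZr commutatorxx commutator_jacobi.

End Endomorphisms.

(** * A twisted loop algebra of the form *)

Section ShiftOperators.
Variables (n : nat) (q : 'rV[int]_n -> int) (B : 'rV[int]_n -> 'rV[int]_n -> int).
Hypotheses (B_biadd : biadditive B) (qB : forall x, q x = B x x).
Variables (K : fieldType) (Y : lmodType K).
Local Notation Lam := 'rV[int]_n.
Local Notation "<< x , y >>" := (polar q x y).

(** Since [B x y + B y x = <x, y>], exchanging the arguments multiplies the sign
    by [(-1)^<x, y>]; these are the signs that the structure constants of a simply
    laced Lie algebra need. *)
Definition cocycle (x y : Lam) : K := (-1) ^ B x y.

Lemma cocycleDl x y z : cocycle (x + y) z = cocycle x z * cocycle y z.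
Proof. by case: B_biadd => BDl _; rewrite /cocycle BDl expfzDr // oppr_eq0 oner_eq0. Qed.

Lemma cocycleDr x y z : cocycle x (y + z) = cocycle x y * cocycle x z.
Proof. by case: B_biadd => _ BDr; rewrite /cocycle BDr expfzDr // oppr_eq0 oner_eq0. Qed.

Lemma cocycleC x y : cocycle y x = (-1) ^ <<x, y>> * cocycle x y.
Proof.
rewrite /cocycle (polarE B_biadd qB) -expfzDr ?oppr_eq0 ?oner_eq0 //.
rewrite addrAC expfzDr ?oppr_eq0 ?oner_eq0 // expfzDr ?oppr_eq0 ?oner_eq0 //.
by rewrite -expfzMl mulrNN mulr1 exp1rz mul1r.
Qed.

Lemma cocycle_neq0 x y : cocycle x y != 0.
Proof. by rewrite expfz_neq0 // oppr_eq0 oner_eq0. Qed.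

(** A function [Lam -> Y] is a possibly infinite sum of homogeneous elements, its
    value at [d] being the component of degree [d].  The operator raises degrees
    by [g] and acts on the component of degree [d] by [R d], up to the sign.
    Every value of the result depends on one value of [f] only, so finiteness of
    supports is not an issue. *)
Definition shift_fun (g : Lam) (R : Lam -> {linear Y -> Y}) (f : Lam -> Y) : Lam -> Y :=
  fun t => cocycle g (t - g) *: R (t - g) (f (t - g)).

Lemma shift_fun_linear g R : shift_fun g R \in @linearb K (Lam -> Y).
Proof.
apply/asboolP=> c f f'; apply/funext=> t.
by rewrite /shift_fun !fctE linearP scalerDr !scalerA mulrC.
Qed.

Definition shift_op g R : endo (Lam -> Y) := Endo (shift_fun_linear g R).

Lemma shift_opE g R f t :
  shift_op g R f t = cocycle g (t - g) *: R (t - g) (f (t - g)).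
Proof. by []. Qed.

(** The sign [cocycle g h * cocycle g d * cocycle h d] can be factored out of the
    commutator, which leaves an identity between the fibre maps whose only sign is
    [(-1)^<g, h>]. *)
Lemma shift_op_lie g h (R S Q : Lam -> {linear Y -> Y}) (c : K) :
  (forall d y, R (h + d) (S d y) - (-1) ^ <<g, h>> *: S (g + d) (R d y) = c *: Q d y) ->
  [lie shift_op g R, shift_op h S] = (c * cocycle g h) *: shift_op (g + h) Q.
Proof.
move=> RSQ; apply: endoP => f; apply/funext=> t.
transitivity (shift_op g R (shift_op h S f) t - shift_op h S (shift_op g R f) t) => //.
transitivity ((c * cocycle g h) *: shift_op (g + h) Q f t); last by [].
rewrite !shift_opE; set d := t - (g + h).
have -> : t - g - h = d by rewrite /d opprD addrA.
have -> : t - h - g = d by rewrite /d opprD addrAC addrA.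
have -> : t - g = h + d by rewrite /d opprD addrCA [h + _]addrCA subrr addr0.
have -> : t - h = g + d by rewrite /d opprD addrCA [g + _]addrA subrr add0r.
clearbody d; rewrite !linearZ /= !scalerA !(cocycleDl, cocycleDr) (cocycleC g h).
set s := cocycle g h * cocycle g d * cocycle h d.
have -> : cocycle h d * (cocycle g h * cocycle g d) = s by rewrite /s; ring.
have -> : (-1) ^ <<g, h>> * cocycle g h * cocycle h d * cocycle g d
    = s * (-1) ^ <<g, h>> by rewrite /s; ring.
have -> : cocycle g d * cocycle h d * (c * cocycle g h) = s * c by rewrite /s; ring.
by clearbody s; rewrite -!scalerA -(RSQ d (f d)) scalerBr !scalerN.
Qed.

End ShiftOperators.

Section LoopAlgebra.
Variables (n : nat) (q : 'rV[int]_n -> int) (B : 'rV[int]_n -> 'rV[int]_n -> int).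
Hypotheses (B_biadd : biadditive B) (qB : forall x, q x = B x x).
Hypothesis q_psd : pos_semidefinite q.
Variables (K : fieldType) (U : lmodType K).
(* U plays the role of the Cartan subalgebra: rho sends a lattice vector to its
   class modulo the radical, and ev u x is the value at u of the weight x. *)
Variables (rho : 'rV[int]_n -> U) (ev : U -> 'rV[int]_n -> K).
Hypotheses (rhoD : forall x y, rho (x + y) = rho x + rho y)
  (rho_iso : forall x, q x = 0 -> rho x = 0).
Hypotheses (evP : forall c u v x, ev (c *: u + v) x = c * ev u x + ev v x)
  (evD : forall u x y, ev u (x + y) = ev u x + ev u y)
  (ev_iso : forall u x, q x = 0 -> ev u x = 0)
  (ev_rho : forall x y, ev (rho x) y = (polar q x y)%:~R).
Local Notation Lam := 'rV[int]_n.
Local Notation "<< x , y >>" := (polar q x y).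
Local Notation qDE := (qD q).
Local Notation pDr := (polarDr B_biadd qB).
Local Notation pDl := (polarDl B_biadd qB).
Local Notation pC := (polarC B_biadd qB).
Local Notation Y := (K^o * U)%type.

(** For all integers [m], [q (y + m x) = q y + m <x, y>] is nonnegative. *)
Lemma isotropic_polar x y : q x = 0 -> <<x, y>> = 0.
Proof.
move=> qx; have q_ge z : 0 <= q z by exact: q_psd.
have qm (m : int) : q (y + x *~ m) = q y + m * <<x, y>>.
  have pm (k : nat) : q (x *+ k) = 0 /\ <<y, x *+ k>> = k%:Z * <<x, y>>.
    elim: k => [|k [IHq IHp]].
      by rewrite mulr0n (q_0 B_biadd qB) (polar0r B_biadd qB) mul0r.
    rewrite mulrS qDE qx IHq pDr IHp (pC y x).
    have -> : <<x, x *+ k>> = 0.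
      elim: (k) => [|l IH]; first by rewrite mulr0n (polar0r B_biadd qB).
      by rewrite mulrS pDr IH (polarxx B_biadd qB) qx.
    by split; lia.
  case: m => k; rewrite /intmul qDE ?(qN B_biadd qB) ?(polarNr B_biadd qB);
    [have [-> ->] := pm k | have [-> ->] := pm k.+1]; lia.
have := q_ge (y + x *~ (- (q y + 1) * <<x, y>>)); rewrite qm.
by have := q_ge y; nia.
Qed.

(** The degree [d] part of the loop algebra is the line [K e_d] if [q d = 1], the
    space [U] if [q d = 0], and 0 otherwise.  A fibre [Y] holds both kinds of
    coordinates, and the tests on [q] discard the coordinates that do not belong
    to the degree.  Up to signs, [real_fun a d] is the bracket with [e_a] on degree
    [d], and [imag_fun a d] is the bracket with the class of [a] placed in any
    isotropic degree. *)
Definition real_fun (a d : Lam) (y : Y) : Y :=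
  ((if q (a + d) == 1 then (if q d == 1 then y.1 else 0)
                           - (if q d == 0 then ev y.2 a else 0) else 0 : K^o),
   if (q (a + d) == 0) && (q d == 1) then y.1 *: rho a else 0).

Definition imag_fun (a d : Lam) (y : Y) : Y :=
  ((if q d == 1 then <<a, d>>%:~R * y.1 else 0 : K^o), 0).

Lemma pair_eq (x y : K) (u v : U) : x = y -> u = v -> (x, u) = (y, v) :> Y.
Proof. by move=> -> ->. Qed.

Lemma ev0 x : ev 0 x = 0.
Proof. by have := evP (-1) 0 0 x; rewrite scaler0 addr0 mulN1r addNr. Qed.

Lemma evZ c u x : ev (c *: u) x = c * ev u x.
Proof. by rewrite -[c *: u]addr0 evP ev0 addr0. Qed.

Lemma scale_regular (c : K) (x : K^o) : c *: x = c * x :> K.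
Proof. by []. Qed.

Lemma real_fun_linear a d : linear (real_fun a d).
Proof.
move=> c [y u] [z v]; rewrite /real_fun; apply: pair_eq; rewrite /=.
- by do 3?case: ifP => _; rewrite ?evP /= !scale_regular; ring.
- by case: ifP => _; rewrite ?scaler0 ?addr0 // scalerDl scalerA.
Qed.

Lemma imag_fun_linear a d : linear (imag_fun a d).
Proof.
move=> c [y u] [z v]; rewrite /imag_fun; apply: pair_eq; rewrite /= ?scaler0 ?addr0 //.
by case: ifP => _; rewrite !scale_regular; ring.
Qed.

HB.instance Definition _ a d :=
  GRing.isLinear.Build K Y Y *:%R (real_fun a d) (real_fun_linear a d).
HB.instance Definition _ a d :=
  GRing.isLinear.Build K Y Y *:%R (imag_fun a d) (imag_fun_linear a d).

Definition real_map a d : {linear Y -> Y} := real_fun a d.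
Definition imag_map a d : {linear Y -> Y} := imag_fun a d.

Lemma fibre_eq (p r : Y) : p.1 = r.1 :> K -> p.2 = r.2 -> p = r.
Proof. by case: p r => [? ?] [? ?] /= -> ->. Qed.

Lemma sign_m1 : (-1 : K) ^ (-1) = -1.
Proof. by rewrite exprN1 invrN1. Qed.

Lemma sign_m2 : (-1 : K) ^ (-2) = 1.
Proof. by rewrite -exprnN sqrrN expr1n invr1. Qed.

Lemma sign_1 : (-1 : K) ^ 1 = -1.
Proof. exact: expr1z. Qed.

Lemma sign_2 : (-1 : K) ^ 2 = 1.
Proof. by rewrite -exprnP sqrrN expr1n. Qed.

Ltac split_ifs := repeat (case: eqP => ? /=; try (by exfalso; lia)).

Ltac mod_simp := rewrite ?(evZ, ev0, ev_rho, subr0, sub0r, addr0, add0r, oppr0,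
  scale0r, scaler0, scaleNr, scalerN, mulr0, opprK, sign_m1, sign_m2, sign_1, sign_2,
  expr0z, scale1r, scaleN1r, subrr, addNr, scalerDr).

(** The Jacobi identity for [e_a], [e_b] and an element of degree [d].  If
    [q d = 1], it only depends on the pairings of [a], [b] and [d], which lie
    between [-2] and 2; a pairing [-2] (or 2) means that the sum (or the
    difference) of the two vectors is isotropic, so that it pairs to 0 with the
    third one. *)
Lemma real_real a b d y : q a = 1 -> q b = 1 ->
  real_fun a (b + d) (real_fun b d y)
  - (-1) ^ <<a, b>> *: real_fun b (a + d) (real_fun a d y)
  = if <<a, b>> == -1 then real_fun (a + b) d y
    else if <<a, b>> == -2 then imag_fun a d y else 0.
Proof.
move=> qa qb.
have [qd1|qd1] := eqVneq (q d) 1; last first.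
  have [qd0|qd0] := eqVneq (q d) 0; last first.
    have real0 x : real_fun x d y = 0.
      by rewrite /real_fun (negPf qd1) (negPf qd0) andbF subrr if_same.
    rewrite !real0 /imag_fun (negPf qd1) (linear0 (real_map _ _)) (linear0 (real_map _ _)).
    by rewrite scaler0 subrr !if_same.
  (* q d = 0: adding d changes neither q nor any pairing *)
  have dp x : <<x, d>> = 0 by rewrite pC isotropic_polar.
  have qxd x : q (x + d) = q x by rewrite qDE qd0 dp !addr0.
  have abE : q (a + (b + d)) = 2 + <<a, b>> by rewrite addrA qxd qDE qa qb.
  have baE : q (b + (a + d)) = 2 + <<a, b>> by rewrite addrCA.
  have ab_ge : 0 <= 2 + <<a, b>> by rewrite -abE.
  case: y => y u; rewrite /real_fun /imag_fun abE baE !qxd qa qb qd0 qDE qa qb evD rhoD /=.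
  have ab_iso : <<a, b>> = -2 -> rho a = - rho b /\ ev u a = - ev u b.
    move=> ab2; have qab : q (a + b) = 0 by rewrite qDE qa qb ab2.
    have := rho_iso qab; have := ev_iso u qab; rewrite rhoD evD.
    by split; apply/eqP; rewrite -addr_eq0; apply/eqP.
  have [ab|ab] := eqVneq <<a, b>> (-2).
    by have [-> ->] := ab_iso ab; rewrite ab; apply: fibre_eq => /=; mod_simp.
  have [ab1|ab1] := eqVneq <<a, b>> (-1).
    rewrite ab1; apply: fibre_eq => /=; mod_simp => //.
    by rewrite opprD addrC.
  by apply: fibre_eq => /=; split_ifs; mod_simp.
have : -2 <= <<a, b>> <= 2.
  have := q_psd (a + b); have := q_psd (a - b).
  by rewrite (qB_sub B_biadd qB) qDE qa qb; lia.
case/andP=> ab_ge ab_le.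
have abm_iso : <<a, b>> = -2 -> [/\ <<b, d>> = - <<a, d>> & rho a = - rho b].
  move=> ab2; have qab : q (a + b) = 0 by rewrite qDE qa qb ab2.
  have := isotropic_polar d qab; rewrite pDl => E; split; first by lia.
  by have := rho_iso qab; rewrite rhoD => /eqP; rewrite addr_eq0 => /eqP.
have abp_iso : <<a, b>> = 2 -> <<b, d>> = <<a, d>>.
  move=> ab2; have qab : q (a - b) = 0 by rewrite (qB_sub B_biadd qB) qa qb ab2.
  by have := isotropic_polar d qab; rewrite pDl (polarNl B_biadd qB) => E; lia.
have := q_psd (b + d); have := q_psd (a + d); have := q_psd (a + (b + d)).
have := @isotropic_polar (b + d) a; have := @isotropic_polar (a + d) b.
case: y => y u; rewrite /real_fun /imag_fun.
have ba : <<b, a>> = <<a, b>> by rewrite pC.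
have -> : a + b + d = a + (b + d) by rewrite addrA.
have -> : b + (a + d) = a + (b + d) by rewrite addrCA.
rewrite !qDE !(pDr, pDl) (pC b a) (pC d a) (pC d b) qa qb qd1 rhoD evD /=.
have: [\/ <<a, b>> = -2, <<a, b>> = -1 | 0 <= <<a, b>>].
  by case: (ltgtP <<a, b>> (-1)) => ?; [apply: Or31 | apply: Or33 | apply: Or32]; lia.
case=> ab.
- have [bd rho_ab] := abm_iso ab; rewrite ab bd => _ _ _ ad_ge bd_ge.
  have : [\/ <<a, d>> = -2, <<a, d>> = -1
           | [\/ <<a, d>> = 0, <<a, d>> = 1 | <<a, d>> = 2]].
    by case: (ltgtP <<a, d>> 0) => ?; case: (ltgtP <<a, d>> (-1)) => ?;
       case: (ltgtP <<a, d>> 1) => ?; try lia;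
       [apply: Or31 | apply: Or32 | apply/Or33/Or33 | apply/Or33/Or32 | apply/Or33/Or31];
       lia.
  by case=> [||[]] ->; apply: fibre_eq => /=; mod_simp; rewrite ?ba ?ab // ?rho_ab;
     try by []; ring.
- rewrite ab => *.
  by apply: fibre_eq => /=; split_ifs; mod_simp; rewrite ?ba ?ab; try by []; ring.
- have : [\/ <<a, b>> = 0, <<a, b>> = 1 | <<a, b>> = 2].
    by case: (ltgtP <<a, b>> 1) => ?; [apply: Or31 | apply: Or33 | apply: Or32]; lia.
  by case=> {}ab; rewrite ab in abp_iso *; move=> *; apply: fibre_eq => /=;
     split_ifs; mod_simp; rewrite ?ba ?ab; try by []; ring.
Qed.

Lemma real_imag a b g d y : q a = 1 -> q g = 0 ->
  real_fun a (g + d) (imag_fun b d y)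
  - (-1) ^ <<a, g>> *: imag_fun b (a + d) (real_fun a d y)
  = - <<b, a>>%:~R *: real_fun (a + g) d y.
Proof.
move=> qa qg; case: y => y u; rewrite /real_fun /imag_fun.
have gp x : <<g, x>> = 0 by exact: isotropic_polar.
have pg x : <<x, g>> = 0 by rewrite pC.
have -> : a + g + d = g + (a + d) by rewrite addrAC addrC.
have -> : a + (g + d) = g + (a + d) by rewrite addrCA.
rewrite !(qDE g) qg !gp pg !add0r !addr0 rhoD evD (rho_iso qg) (ev_iso u qg) !addr0.
rewrite expr0z scale1r.
have ad_iso := @isotropic_polar (a + d) b.
have bd_iso : q d = 0 -> <<b, d>> = 0 by move=> qd; rewrite pC isotropic_polar.
rewrite pC pDr in ad_iso; rewrite pDr.
move: <<b, a>> <<b, d>> ad_iso bd_iso => ba bd ad_iso bd_iso.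
apply: fibre_eq; rewrite /= ?scale_regular.
  have [qd|qd] := eqVneq (q d) 1; have [qad|qad] := eqVneq (q (a + d)) 1;
    rewrite ?qd /= ?intrD; try ring.
  by have [/bd_iso ->|qd0] := eqVneq (q d) 0; rewrite ?ev0 ?mulr0z; ring.
have [ad0|ad0] := eqVneq (q (a + d)) 0; last by rewrite scaler0 subr0.
have [qd|qd] := eqVneq (q d) 1; last by rewrite scaler0 subr0.
have -> : bd = - ba by have := ad_iso ad0; lia.
by rewrite subr0 scalerA mulrNz.
Qed.

Lemma imag_imag a b g h d y : q g = 0 -> q h = 0 ->
  imag_fun a (h + d) (imag_fun b d y)
  - (-1) ^ <<g, h>> *: imag_fun b (g + d) (imag_fun a d y) = 0.
Proof.
move=> qg qh; case: y => y u; rewrite /imag_fun.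
have iso z x : q z = 0 -> <<z, x>> = 0 by exact: isotropic_polar.
have isoC z x : q z = 0 -> <<x, z>> = 0 by move=> qz; rewrite pC iso.
rewrite !qDE qg qh !(pDr, iso _ _ qg, iso _ _ qh, isoC _ _ qg, isoC _ _ qh).
rewrite !add0r !addr0 expr0z scale1r.
apply: fibre_eq => /=; last by rewrite subrr.
by case: eqP => _; rewrite ?mulr0 ?subrr // mulrCA subrr.
Qed.

Local Notation E a := (shift_op B a (real_map a)).
Local Notation T a g := (shift_op B g (imag_map a)).
Local Notation coc := (cocycle B K).

Lemma lie_real_real a b : q a = 1 -> q b = 1 ->
  [lie E a, E b] = if <<a, b>> == -1 then coc a b *: E (a + b)
                   else if <<a, b>> == -2 then coc a b *: T a (a + b) else 0.
Proof.
move=> qa qb; have ab d y := @real_real a b d y qa qb.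
have [ab1|ab1] := eqVneq <<a, b>> (-1).
  rewrite (shift_op_lie B_biadd qB (Q := real_map (a + b)) (c := 1)) ?mul1r // => d y.
  by rewrite scale1r; have := ab d y; rewrite ab1.
have [ab2|ab2] := eqVneq <<a, b>> (-2).
  rewrite (shift_op_lie B_biadd qB (Q := imag_map a) (c := 1)) ?mul1r // => d y.
  by rewrite scale1r; have := ab d y; rewrite ab2.
rewrite (shift_op_lie B_biadd qB (Q := imag_map a) (c := 0)) ?mul0r ?scale0r // => d y.
by rewrite scale0r; have := ab d y; rewrite (negPf ab1) (negPf ab2).
Qed.

Lemma lie_real_imag a b g : q a = 1 -> q g = 0 ->
  [lie E a, T b g] = (- <<b, a>>%:~R * coc a g) *: E (a + g).
Proof.
by move=> qa qg; apply: (shift_op_lie B_biadd qB) => d y; exact: real_imag.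
Qed.

Lemma lie_imag_imag a b g h : q g = 0 -> q h = 0 -> [lie T a g, T b h] = 0.
Proof.
move=> qg qh; rewrite (shift_op_lie B_biadd qB (Q := imag_map a) (c := 0)).
  by rewrite mul0r scale0r.
move=> d y.
by rewrite scale0r; exact: imag_imag.
Qed.

Hypothesis q_basis : forall i, q (@basis_vec n i) = 1.
Local Notation e := (@basis_vec n).

Lemma cocycle0r x : coc x 0 = 1.
Proof.
apply: (mulfI (cocycle_neq0 B K x 0)).
by rewrite -(cocycleDr B_biadd) addr0 mulr1.
Qed.

Lemma imagN a g : T (- a) g = - T a g.
Proof.
apply: endoP => f; apply/funext => t.
transitivity (- (T a g f t)) => //; rewrite !shift_opE -scalerN; congr (_ *: _).
rewrite /imag_map /imag_fun; apply: fibre_eq; rewrite /= ?oppr0 // (polarNl B_biadd qB).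
by case: ifP; rewrite ?oppr0 // mulrNz mulNr.
Qed.

Definition signed_basis (b : bool) i : Lam := (-1) ^+ b *: e i.

Lemma q_signed_basis b i : q (signed_basis b i) = 1.
Proof.
by case: b; rewrite /signed_basis ?scaleN1r ?scale1r ?(qN B_biadd qB) q_basis.
Qed.

(** The sign of the image of [x_(-i)] is forced by [[x_i, x_(-i)] = h_i], because
    [cocycle e_i (- e_i) = -1]. *)
Definition G_to_loop_gen (x : G_gen n) : endo (Lam -> Y) :=
  match x with
  | GX b i => (-1) ^+ b *: E (signed_basis b i)
  | GH i => T (e i) 0
  end.

Definition homogeneous (w : Lam) (z : endo (Lam -> Y)) : Prop :=
  [\/ z = 0, q w = 1 /\ exists c, z = c *: E w
   | q w = 0 /\ exists c a, z = c *: T a w].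

Lemma homogeneous_lie a w z : q a = 1 -> homogeneous w z -> homogeneous (a + w) [lie E a, z].
Proof.
move=> qa [->|[qw [c ->]]|[qw [c [b ->]]]]; first by rewrite lie0r; apply: Or31.
  rewrite lieZr lie_real_real //.
  have [aw|aw] := eqVneq <<a, w>> (-1).
    by apply: Or32; rewrite qDE qa qw aw scalerA; split=> //; eexists.
  have [aw2|aw2] := eqVneq <<a, w>> (-2); last by rewrite scaler0; apply: Or31.
  by apply: Or33; rewrite qDE qa qw aw2 scalerA; split=> //; do 2!eexists.
rewrite lieZr lie_real_imag // scalerA; apply: Or32.
by rewrite qDE qa qw pC isotropic_polar //; split=> //; eexists.
Qed.

(** So a multibracket of generators vanishes unless its degree has [q]-value 0
    or 1, which is the last relation of [G(q)]. *)
Lemma homogeneous_multibracket (w : seq (bool * 'I_n)) :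
  homogeneous (\sum_(p <- w) signed_basis p.1 p.2)
    (multibracket [seq G_to_loop_gen (GX p.1 p.2) | p <- w]).
Proof.
elim: w => [|[b i] [|r w] IH]; first exact: Or31.
  rewrite big_seq1; apply: Or32; split; first exact: q_signed_basis.
  by exists ((-1) ^+ b).
rewrite big_cons; set s := r :: w in IH *.
have -> : multibracket [seq G_to_loop_gen (GX p.1 p.2) | p <- (b, i) :: s]
  = (-1) ^+ b *: [lie E (signed_basis b i), multibracket [seq G_to_loop_gen (GX p.1 p.2) | p <- s]].
  by rewrite -lieZl.
have [->|[qw [c ->]]|[qw [c [a ->]]]] := homogeneous_lie (q_signed_basis b i) IH.
- by rewrite scaler0; apply: Or31.
- by apply: Or32; split=> //; rewrite scalerA; eexists.
- by apply: Or33; split=> //; rewrite scalerA; do 2!eexists.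
Qed.

Lemma G_rel_loop x : G_rel q x -> free_lift G_to_loop_gen x = 0.
Proof.
have gM := free_lift_morphism G_to_loop_gen; have [gD gZ gL] := gM.
have g_x b i : free_lift G_to_loop_gen (G_x K b i) = (-1) ^+ b *: E (signed_basis b i).
  exact: free_lift_var.
have g_h i : free_lift G_to_loop_gen (G_h K i) = T (e i) 0 by exact: free_lift_var.
case=> {x} [i j|i j b|i b|w qw].
- by rewrite gL !g_h lie_imag_imag // (q_0 B_biadd qB).
- rewrite (lie_morphB gM) gL gZ g_x g_h lieZr lie_anti.
  rewrite lie_real_imag ?q_signed_basis ?(q_0 B_biadd qB) //.
  rewrite addr0 cocycle0r mulr1 scaleNr opprK !scalerA -scalerBl.
  rewrite [<<_, signed_basis b j>>](_ : _ = (-1) ^+ b * <<e i, e j>>).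
    by rewrite mulrC subrr scale0r.
  by case: b; rewrite /signed_basis ?scaleN1r ?scale1r ?(polarNr B_biadd qB) ?mulN1r ?mul1r.
- rewrite (lie_morphB gM) gL gZ !g_x g_h.
  have sN : signed_basis (~~ b) i = - signed_basis b i.
    by case: b; rewrite /signed_basis /= ?scaleN1r ?scale1r ?opprK.
  rewrite sN lieZl lieZr lie_real_real ?(qN B_biadd qB) ?q_signed_basis //.
  rewrite (polarNr B_biadd qB) (polarxx B_biadd qB) q_signed_basis /= subrr.
  have -> : coc (signed_basis b i) (- signed_basis b i) = -1.
    have := cocycleDr B_biadd K (signed_basis b i) (signed_basis b i) (- signed_basis b i).
    rewrite subrr cocycle0r {1}/cocycle -qB q_signed_basis expr1z mulN1r => E1.
    by apply/eqP; rewrite -eqr_opp opprK -E1.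
  rewrite /signed_basis; case: b {sN}; rewrite /= ?scaleN1r ?scale1r ?imagN ?opprK ?subrr ?addNr //.
- rewrite (lie_morph_multibracket gM) -map_comp.
  rewrite (@eq_map _ _ _ (fun p => G_to_loop_gen (GX p.1 p.2))); last first.
    by move=> p; rewrite /= g_x.
  by have [E0|[qw1 _]|[qw1 _]] := homogeneous_multibracket w;
    [exact: E0 | rewrite qw1 in qw | rewrite qw1 in qw].
Qed.

(** Applied to the Cartan element [rho t] in degree 0, the operator [E x] yields
    [- <t, x>] times [e_x], up to a sign; the component of degree [t] of the result
    detects whether [x = t]. *)
Definition loop_coef_vec (t : Lam) : Lam -> Y := fun d => (0, if d == 0 then rho t else 0).
Definition loop_coef (t : Lam) (z : endo (Lam -> Y)) : K := (z (loop_coef_vec t) t).1.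

Lemma loop_coef_linear t : scalar (loop_coef t).
Proof.
move=> c z z'; rewrite /loop_coef endoDE endoZE.
by move: (z _) (z' _) => f f'; rewrite !fctE.
Qed.

HB.instance Definition _ t :=
  GRing.isLinear.Build K (endo (Lam -> Y)) K *%R (loop_coef t) (loop_coef_linear t).

Lemma loop_coef_real t x : (2%:R : K) != 0 -> q x = 1 -> (loop_coef t (E x) == 0) = (x != t).
Proof.
move=> K2 qx.
have -> : loop_coef t (E x)
  = coc x (t - x) * (real_fun x (t - x) (loop_coef_vec t (t - x))).1 by [].
rewrite mulf_eq0 (negPf (cocycle_neq0 _ _ _ _)) /= /loop_coef_vec.
have [<-|xt] := eqVneq x t.
  rewrite subrr eqxx addr0 qx (q_0 B_biadd qB) /= ev_rho (polarxx B_biadd qB) qx.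
  by rewrite sub0r oppr_eq0 (negPf K2).
have -> : (t - x == 0) = false by rewrite subr_eq0 eq_sym (negPf xt).
by rewrite /real_fun /= ev0 !if_same subrr !if_same eqxx.
Qed.

Lemma loop_root_multibracket s : is_root q s ->
  exists2 c, c != 0 & multibracket [seq E (e i) | i <- s] = c *: E (weight s).
Proof.
elim: s => [|i [|j s] IH] //.
  by exists 1; rewrite ?oner_eq0 // scale1r /weight big_seq1.
move=> r; have /andP[/eqP ij rs] : (<<e i, weight (j :: s)>> == -1) && is_root q (j :: s) := r.
have [c c0 mbE] := IH rs.
have -> : multibracket [seq E (e k) | k <- [:: i, j & s]]
  = [lie E (e i), multibracket [seq E (e k) | k <- j :: s]] by [].
rewrite mbE lieZr lie_real_real ?(q_weight_root q_basis rs) // ij eqxx scalerA -weight_cons.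
exists (c * coc (e i) (weight (j :: s))) => //.
by rewrite mulf_neq0 // cocycle_neq0.
Qed.

Lemma loop_model : (2%:R : K) != 0 ->
  exists (M : lieAlgType K) (g : G_alg K q -> M) (coef : Lam -> {scalar M}),
    lie_morphism g /\ forall x s, is_root q s ->
      (coef x (g (multibracket [seq lie_pi (@G_rel K n q) (G_x K false i) | i <- s])) == 0)
      = (weight s != x).
Proof.
move=> K2.
pose g : G_alg K q -> endo (Lam -> Y) := quot_lift (free_lift G_to_loop_gen).
have gM : lie_morphism g := quot_lift_morphism (free_lift_morphism _) G_rel_loop.
have g_gen i : g (lie_pi (@G_rel K n q) (G_x K false i)) = E (e i).
  rewrite /g (quot_lift_pi (free_lift_morphism _) G_rel_loop) free_lift_var /=.
  by rewrite expr0 scale1r /signed_basis expr0 scale1r.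
exists (endo (Lam -> Y)), g, (fun t => loop_coef t); split=> // x s rs.
rewrite (lie_morph_multibracket gM) -map_comp (eq_map g_gen).
have [c c0 ->] := loop_root_multibracket rs.
rewrite linearZ /= mulf_eq0 (negPf c0) /= loop_coef_real //.
exact: q_weight_root.
Qed.

End LoopAlgebra.

(** ** The quotient of the lattice by the radical *)

Section GramMatrix.
Variables (n : nat) (q : 'rV[int]_n -> int) (B : 'rV[int]_n -> 'rV[int]_n -> int).
Hypotheses (B_biadd : biadditive B) (qB : forall x, q x = B x x).
Hypothesis q_psd : pos_semidefinite q.
Variable K : fieldType.
Local Notation "<< x , y >>" := (polar q x y).
Local Notation e := (@basis_vec n).

Definition gram : 'M[K]_n := \matrix_(i, j) <<e i, e j>>%:~R.
Definition cast_row (x : 'rV[int]_n) : 'rV[K]_n := map_mx intr x.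
(** A model of the lattice modulo its radical: [rad_proj x] depends only on
    [cast_row x *m gram], the row of all pairings with [x], and it has the same
    pairings as [x] because [A *m pinvmx gram *m gram = A] when the row space of
    [A] is contained in that of [gram]. *)
Definition rad_proj (x : 'rV[int]_n) : 'rV[K]_n := cast_row x *m gram *m pinvmx gram.
Definition gram_eval (u : 'rV[K]_n) (x : 'rV[int]_n) : K :=
  (u *m gram *m (cast_row x)^T) 0 0.

Lemma cast_rowD x y : cast_row (x + y) = cast_row x + cast_row y.
Proof. exact: map_mxD. Qed.

Lemma cast_row_gram x j : (cast_row x *m gram) 0 j = <<x, e j>>%:~R.
Proof.
rewrite mxE (polarC B_biadd qB) (polar_coord B_biadd qB) rmorph_sum.
by apply: eq_bigr => i _; rewrite !mxE rmorphM (polarC B_biadd qB).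
Qed.

Lemma gram_cast_col x i : (gram *m (cast_row x)^T) i 0 = <<e i, x>>%:~R.
Proof.
rewrite mxE (polar_coord B_biadd qB) rmorph_sum.
by apply: eq_bigr => j _; rewrite !mxE rmorphM mulrC.
Qed.

Lemma rad_projD x y : rad_proj (x + y) = rad_proj x + rad_proj y.
Proof. by rewrite /rad_proj cast_rowD !mulmxDl. Qed.

Lemma rad_proj_isotropic x : q x = 0 -> rad_proj x = 0.
Proof.
move=> qx; rewrite /rad_proj (_ : cast_row x *m gram = 0) ?mul0mx //.
by apply/rowP=> j; rewrite cast_row_gram (isotropic_polar B_biadd qB q_psd) // mxE.
Qed.

Lemma gram_eval_linear c u v x :
  gram_eval (c *: u + v) x = c * gram_eval u x + gram_eval v x.
Proof. by rewrite /gram_eval !mulmxDl -!scalemxAl !mxE. Qed.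

Lemma gram_evalD u x y : gram_eval u (x + y) = gram_eval u x + gram_eval u y.
Proof. by rewrite /gram_eval cast_rowD linearD mulmxDr mxE. Qed.

Lemma gram_eval_isotropic u x : q x = 0 -> gram_eval u x = 0.
Proof.
move=> qx; rewrite /gram_eval -mulmxA (_ : gram *m _ = 0) ?mulmx0 ?mxE //.
apply/colP=> i.
by rewrite gram_cast_col (polarC B_biadd qB) (isotropic_polar B_biadd qB q_psd) // mxE.
Qed.

Lemma gram_eval_proj x y : gram_eval (rad_proj x) y = <<x, y>>%:~R.
Proof.
rewrite /gram_eval /rad_proj mulmxKpV ?submxMl // -mulmxA mxE.
rewrite (polarC B_biadd qB) (polar_coord B_biadd qB) rmorph_sum; apply: eq_bigr => i _.
by rewrite gram_cast_col !mxE rmorphM (polarC B_biadd qB).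
Qed.

Lemma loop_model_exists : (forall i, q (e i) = 1) -> (2%:R : K) != 0 ->
  exists (M : lieAlgType K) (g : G_alg K q -> M) (coef : 'rV[int]_n -> {scalar M}),
    lie_morphism g /\ forall x s, is_root q s ->
      (coef x (g (multibracket [seq lie_pi (@G_rel K n q) (G_x K false i) | i <- s])) == 0)
      = (weight s != x).
Proof.
move=> q_basis; apply: (loop_model B_biadd qB q_psd (rho := rad_proj) (ev := gram_eval)) => //.
- exact: rad_projD.
- exact: rad_proj_isotropic.
- exact: gram_eval_linear.
- exact: gram_evalD.
- exact: gram_eval_isotropic.
- exact: gram_eval_proj.
Qed.

End GramMatrix.

(** * The isomorphism *)

Section Comparison.
Variables (n : nat) (q : 'rV[int]_n -> int) (K : fieldType).
Local Notation e := (@basis_vec n).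
Local Notation "<< x , y >>" := (polar q x y).
Hypotheses (q_basis : forall i, q (e i) = 1) (q_wpos : weakly_positive q).
Local Notation L := (L_alg K q).
Local Notation G := (G_alg K q).
Local Notation Gp := (G_plus K q).

Lemma G_plus_gen_subproof i : lie_pi (@G_rel K n q) (G_x K false i) \in subalgb (@G_pos_gen K n q).
Proof. exact/asboolP/sg_mem/GPosGen. Qed.

Definition G_plus_gen (i : 'I_n) : Gp := LieSubalg (G_plus_gen_subproof i).

Lemma G_plus_val_morphism : lie_morphism (fun x : Gp => val x : G).
Proof. by []. Qed.

(** The value is [2 + <e_i, weight s>]; it is positive by weak positivity, and it
    is not 1 as [i :: s] is not a root. *)
Lemma non_root_q_gt1 i s : is_root q s -> ~~ is_root q (i :: s) ->
  1 < q (weight (i :: s)).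
Proof.
move=> rs nr; rewrite weight_cons.
have qs := q_weight_root q_basis rs.
have sN0 : weight s != 0.
  apply/eqP=> /(congr1 (@height n)); rewrite height_weight /height big1 => [|j _].
    by case: s rs {nr qs}.
  by rewrite mxE.
have := q_gt0 q_wpos (nonnegD (nonneg_basis i) (weight_nonneg s)).
rewrite addr_nonneg_neq0 //; last 3 first.
- exact: nonneg_basis.
- exact: weight_nonneg.
- by apply/eqP=> /(congr1 (@height n)); rewrite height_basis /height big1 // => j _; rewrite mxE.
move=> /(_ isT); rewrite qD q_basis qs.
suff : <<e i, weight s>> != -1 by lia.
by move: nr; case: s rs {qs sN0} => [//|j s] rs; apply: contra => isr; apply/andP; split.
Qed.

Lemma G_plus_multibracket_eq0 i s : is_root q s -> ~~ is_root q (i :: s) ->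
  multibracket [seq G_plus_gen j | j <- i :: s] = 0.
Proof.
move=> rs nr; apply: val_inj; rewrite (lie_morph_multibracket G_plus_val_morphism) -map_comp.
rewrite [RHS](_ : _ = 0) //.
pose w := [seq (false, j) | j <- i :: s].
have w0 : lie_pi (@G_rel K n q) (multibracket [seq G_x K p.1 p.2 | p <- w]) = 0.
  rewrite -(lie_pi0 (@G_rel K n q)); apply/lie_piP; rewrite subr0.
  apply/ig_mem/G_rel4; rewrite big_map.
  rewrite (eq_bigr (fun j => e j)) => [|j _]; last by rewrite /= scale1r.
  exact: non_root_q_gt1.
by rewrite -[RHS]w0 (lie_morph_multibracket (lie_pi_morphism _)) -!map_comp.
Qed.

Definition L_to_G_plus : L -> Gp := quot_lift (free_lift G_plus_gen).

Lemma L_to_G_plus_rel x : non_root_bracket q x -> free_lift G_plus_gen x = 0.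
Proof.
case=> i s nr rs.
rewrite (lie_morph_multibracket (free_lift_morphism _)) -map_comp.
rewrite (eq_map (free_lift_var G_plus_gen)).
exact: G_plus_multibracket_eq0.
Qed.

Lemma L_to_G_plus_morphism : lie_morphism L_to_G_plus.
Proof. exact: quot_lift_morphism (free_lift_morphism _) L_to_G_plus_rel. Qed.

Lemma L_to_G_plus_gen i : L_to_G_plus (L_gen q K i) = G_plus_gen i.
Proof.
rewrite /L_to_G_plus /L_gen (quot_lift_pi (free_lift_morphism _) L_to_G_plus_rel).
exact: free_lift_var.
Qed.

Lemma L_to_G_plus_surj y : exists u, L_to_G_plus u = y.
Proof.
have [fD fZ fL] := L_to_G_plus_morphism.
suff: exists u, val (L_to_G_plus u) = val y by case=> u /val_inj yE; exists u.
have /asboolP : val y \in subalgb (@G_pos_gen K n q) := lie_subalg_valP y.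
elim=> {y} [_ [j]||x y _ [u <-] _ [w <-]|c x _ [u <-]|x y _ [u <-] _ [w <-]].
- by exists (L_gen q K j); rewrite L_to_G_plus_gen.
- by exists 0; rewrite (lie_morph0 L_to_G_plus_morphism).
- by exists (u + w); rewrite fD.
- by exists (c *: u); rewrite fZ.
- by exists [lie u, w]; rewrite fL.
Qed.

Variable B : 'rV[int]_n -> 'rV[int]_n -> int.
Hypotheses (B_biadd : biadditive B) (qB : forall x, q x = B x x).
Hypotheses (q_psd : pos_semidefinite q) (K2 : (2%:R : K) != 0).
Hypothesis polar_basis : forall i j, i != j -> -1 <= <<e i, e j>> <= 1.


Lemma L_to_G_plus_inj u : L_to_G_plus u = 0 -> u = 0.
Proof.
have [M [g [coef [gM coef_br]]]] := loop_model_exists B_biadd qB q_psd q_basis K2.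
have [gD gZ gL] := gM; have [fD fZ fL] := L_to_G_plus_morphism.
have gfM : lie_morphism (fun u => g (val (L_to_G_plus u))).
  by split=> [x y|c x|x y]; rewrite ?fD ?fZ ?fL /= ?gD ?gZ ?gL.
move=> u0; apply: (weight_injective B_biadd qB q_basis q_wpos polar_basis (coef := coef) gfM).
  move=> x s rs; rewrite -coef_br // /L_br (lie_morph_multibracket L_to_G_plus_morphism).
  rewrite (lie_morph_multibracket G_plus_val_morphism) -!map_comp.
  by rewrite (@eq_map _ _ _ (fun i => lie_pi (@G_rel K n q) (G_x K false i))) // => i;
     rewrite /= L_to_G_plus_gen.
by rewrite u0 (lie_morph0 gM).
Qed.

Lemma L_G_plus_isomorphic : lie_isomorphic L Gp.
Proof.
have [fD fZ fL] := L_to_G_plus_morphism.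
have f_lin : linear L_to_G_plus by move=> c x y; rewrite fD fZ.
pose f : {linear L -> Gp} :=
  HB.pack L_to_G_plus (GRing.isLinear.Build K L Gp *:%R L_to_G_plus f_lin).
exists f; split; last exact: fL.
have f_inj : injective L_to_G_plus.
  move=> x y xy; apply/eqP; rewrite -subr_eq0; apply/eqP/L_to_G_plus_inj.
  by rewrite (lie_morphB L_to_G_plus_morphism) xy subrr.
pose h y := projT1 (cid (L_to_G_plus_surj y)).
have hK y : L_to_G_plus (h y) = y by rewrite /h; case: cid.
by exists h => // x; apply: f_inj; rewrite hK.
Qed.

End Comparison.

(** * Unit forms *)

Section UnitForm.
Variables (n : nat) (a : 'M[int]_n).
Local Notation e := (@basis_vec n).

(** The biadditive form of the upper triangular Gram matrix of [unit_form a]. *)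
Definition triangular_form (x y : 'rV[int]_n) : int :=
  \sum_i x 0 i * y 0 i + \sum_(i < n) \sum_(j < n | (i < j)%N) a i j * x 0 i * y 0 j.

Lemma triangular_form_biadditive : biadditive triangular_form.
Proof.
split=> x y z; rewrite /triangular_form addrACA; congr (_ + _); rewrite -big_split /=;
  apply: eq_bigr => i _; rewrite ?mxE ?mulrDl ?mulrDr //;
  rewrite -big_split /=; apply: eq_bigr => j _; rewrite ?mxE; ring.
Qed.

Lemma unit_form_triangular x : unit_form a x = triangular_form x x.
Proof. by []. Qed.

Lemma triangular_form_basis i j :
  triangular_form (e i) (e j) = (i == j)%:Z + (if (i < j)%N then a i j else 0).
Proof.
rewrite /triangular_form; congr (_ + _).
  rewrite (bigD1 i) //= big1 ?addr0 => [|k /negPf ki]; last by rewrite basisE ki mul0r.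
  by rewrite !basisE eqxx mul1r.
rewrite (bigD1 i) //= [X in _ + X]big1 ?addr0 => [|k /negPf ki]; last first.
  by apply: big1 => l _; rewrite basisE ki mulr0 mul0r.
rewrite big_mkcond (bigD1 j) //= [X in _ + X]big1 ?addr0 => [|l /negPf lj]; last first.
  by case: ifP; rewrite // (basisE j) lj mulr0.
by case: ifP => _; rewrite // !basisE !eqxx !mulr1.
Qed.

Lemma unit_form_basis i : unit_form a (e i) = 1.
Proof. by rewrite unit_form_triangular triangular_form_basis eqxx ltnn. Qed.

Lemma polar_unit_form_basis i j : i != j ->
  polar (unit_form a) (e i) (e j) = if (i < j)%N then a i j else a j i.
Proof.
move=> ij; rewrite (polarE triangular_form_biadditive unit_form_triangular).
rewrite !triangular_form_basis (negPf ij) eq_sym (negPf ij) !add0r.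
by case: ltngtP => [||/val_inj /eqP]; rewrite ?addr0 ?add0r // (negPf ij).
Qed.

End UnitForm.

Theorem proposition4p4 (R : realType) (n : nat) (a : 'M[int]_n)
    (a_sym : forall i j, a j i = a i j)
    (a_val : forall i j, i != j -> a i j \in [:: -1; 0; 1])
    (q_conn : form_connected a)
    (q_wpos : weakly_positive (unit_form a))
    (q_psd : pos_semidefinite (unit_form a)) :
  lie_isomorphic (L_alg R[i] (unit_form a)) (G_plus R[i] (unit_form a)).
Proof.
apply: (L_G_plus_isomorphic (@unit_form_basis n a) q_wpos (@triangular_form_biadditive n a)
  (unit_form_triangular a) q_psd); first by rewrite pnatr_eq0.
move=> i j ij; rewrite polar_unit_form_basis // (a_sym i j) if_same.
by have := a_val i j ij; rewrite !inE => /or3P[] /eqP ->.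
Qed.
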